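(* Let $A\in\mathbb{H}_d[z,z^{-1}]$ satisfy $A^\dagger=-A$ and be invertible on the unit circle, with symmetric partial indices $\mathcal{K}=\{\kappa_1\ge\dots\ge\kappa_d\}$. Then there exists a factorization $A=A_+D_4A_+^\dagger$ with $A_+\in\mathbb{H}_d[z]$ invertible for all $|z|\le1$ and $$D_4=-\sum_{m\in\mathcal{M}_+}\big(z^{\kappa_m}|\bar m\rangle\langle m|-z^{-\kappa_m}|m\rangle\langle\bar m|\big)\mathbf{1}_{\mathbb{H}}+\sum_{m\in\mathcal{M}_0}|m\rangle\langle m|\,\mathbf{k}.$$
   Context: Quaternions are realized as real combinations of $\mathbf{1}_{\mathbb{H}}=I_2$, $\mathbf{i}=i\sigma_x$, $\mathbf{j}=i\sigma_y$, $\mathbf{k}=i\sigma_z$; so $\mathbb{H}_d\subset\mathbb{C}_{2d}$ is the set of $Q$ with $(I_d\otimes\sigma_y)\overline{Q}(I_d\otimes\sigma_y)=Q$, and $|m\rangle\langle m'|\mathbf{1}_{\mathbb{H}}$, $|m\rangle\langle m|\mathbf{k}$ denote the $2\times2$ blocks $I_2$, $i\sigma_z$ placed at block position $(m,m')$, $(m,m)$. $\mathbb{H}_d[z,z^{-1}]$ denotes Laurent polynomials $\sum_{r}a_rz^r$ with $a_r\in\mathbb{H}_d$; $\mathbb{H}_d[z]$ those with only nonnegative powers; $A^\dagger(z):=\sum_r a_r^\dagger z^{-r}$. A standard WH factorization of a complex matrix Laurent polynomial invertible on $|z|=1$ is $A=A_+DA_-$, $A_+$ polynomial in $z$ invertible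 for $|z|\le1$, $A_-$ polynomial in $z^{-1}$ invertible for $|z^{-1}|\le1$, $D=\mathrm{diag}(z^{\kappa_1},\dots)$ with nonincreasing integer partial indices, which are unique. For $A\in\mathbb{H}_d[z,z^{-1}]$ viewed in $\mathbb{C}_{2d}[z,z^{-1}]$ the $2d$ standard partial indices occur in equal pairs; the symmetric partial indices $\mathcal{K}$ keep one of each pair. $\mathcal{M}_\pm=\{m:\pm\kappa_m>0\}$, $\mathcal{M}_0=\{m:\kappa_m=0\}$, $\bar m=d+1-m$. *)

(* Defs.v *)
(* complex numbers C := R[i] for R : realType (any realType is
   isomorphic to the reals, so R[i] is the field of complex numbers). *)
From HB Require Import structures.
From mathcomp Require Import all_boot all_order all_algebra.
From mathcomp Require Import reals complex.
Set Implicit Arguments. Unset Strict Implicit. Unset Printing Implicit Defensive.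
Import Order.TTheory GRing.Theory Num.Theory.
Local Open Scope ring_scope.

Section Defs.
Variable C : numClosedFieldType.

(* ---------- ordinals for the block structure of 2d x 2d matrices ---------- *)
(* index i of 'I_(2*d) <-> block (i %/ 2 : 'I_d), inner index (i %% 2 : 'I_2) *)
Lemma half_ord_proof (d : nat) (i : 'I_(2 * d)) : (i %/ 2 < d)%N.
Proof. by rewrite ltn_divLR // -(mulnC 2); exact: ltn_ord. Qed.
Definition half_ord (d : nat) (i : 'I_(2 * d)) : 'I_d := Ordinal (half_ord_proof i).
Definition par_ord (i : nat) : 'I_2 := Ordinal (@ltn_pmod i 2 isT).

(* the 2x2 block B placed at block position (m, m') *)
Definition blk (d : nat) (m m' : 'I_d) (B : 'M[C]_2) : 'M[C]_(2 * d) :=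
  \matrix_(i, j) if (half_ord i == m) && (half_ord j == m')
                 then B (par_ord i) (par_ord j) else 0.

(* Pauli matrices and quaternion units as 2x2 complex matrices *)
Definition sigma_x : 'M[C]_2 := \matrix_(a, b) if a != b then 1 else 0.
Definition sigma_y : 'M[C]_2 :=
  \matrix_(a, b) if (a == 0) && (b == 1) then - 'i
                 else if (a == 1) && (b == 0) then 'i else 0.
Definition sigma_z : 'M[C]_2 :=
  \matrix_(a, b) if a == b then (if a == 0 then 1 else -1) else 0.
Definition qone : 'M[C]_2 := 1%:M.
Definition qk : 'M[C]_2 := 'i *: sigma_z.

(* I_d (x) sigma_y *)
Definition Sy (d : nat) : 'M[C]_(2 * d) := \sum_(m < d) blk m m sigma_y.

(* entrywise conjugate and conjugate transpose *)
Definition mconj n m (M : 'M[C]_(n, m)) := map_mx (fun x => x^*) M.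
Definition adjm n (M : 'M[C]_n) : 'M[C]_n := (mconj M)^T.

(* H_d as a subset of C_{2d} *)
Definition is_quat (d : nat) (Q : 'M[C]_(2 * d)) : bool :=
  Sy d *m mconj Q *m Sy d == Q.

(* ---------- matrix polynomials and Laurent polynomials ---------- *)
(* polynomial in z: coefficient list s, value sum_i s_i z^i *)
Definition peval n (s : seq 'M[C]_n) (z : C) : 'M[C]_n :=
  \sum_(i < size s) (z ^+ i) *: s`_i.

(* Laurent polynomial: sum_i (lp_coef p)_i z^(lp_low p + i) *)
Record lpoly (n : nat) := LPoly { lp_low : int ; lp_coef : seq 'M[C]_n }.

Definition leval n (p : lpoly n) (z : C) : 'M[C]_n :=
  \sum_(i < size (lp_coef p)) (z ^ (lp_low p + i%:Z)) *: (lp_coef p)`_i.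

(* A^dagger(z) = sum_r a_r^dagger z^(-r) *)
Definition ldagger n (p : lpoly n) : lpoly n :=
  LPoly (- (lp_low p + (size (lp_coef p))%:Z - 1)) (rev (map (@adjm n) (lp_coef p))).

(* the polynomial in z with coefficients s, as a Laurent polynomial *)
Definition poly_lpoly n (s : seq 'M[C]_n) : lpoly n := LPoly 0 s.

(* kap is the (nonincreasing) list of standard partial indices of A: there is a
   standard Wiener-Hopf factorization A = A_+ D A_- with D = diag(z^kap_i).
   A_+ has coefficients Ap (polynomial in z), A_-(z) = Am(z^-1) with Am a
   polynomial; equality of Laurent polynomials is equality on C^x. *)
Definition std_partial_indices n (A : lpoly n) (kap : 'I_n -> int) : Prop :=
  (forall i j : 'I_n, (i <= j)%N -> kap j <= kap i) /\
  exists (Ap Am : seq 'M[C]_n),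
    (forall z : C, `|z| <= 1 -> peval Ap z \in unitmx) /\
    (forall w : C, `|w| <= 1 -> peval Am w \in unitmx) /\
    (forall z : C, z != 0 ->
       leval A z = peval Ap z *m diag_mx (\row_i (z ^ kap i)) *m peval Am z^-1).

(* symmetric partial indices: the 2d standard ones are kap_1,kap_1,kap_2,kap_2,... *)
Definition sym_partial_indices d (A : lpoly (2 * d)) (kap : 'I_d -> int) : Prop :=
  std_partial_indices A (fun i : 'I_(2 * d) => kap (half_ord i)).

(* D_4(z) *)
Definition D4 d (kap : 'I_d -> int) (z : C) : 'M[C]_(2 * d) :=
  - (\sum_(m < d | 0 < kap m)
        (z ^ (kap m) *: blk (rev_ord m) m qone
         - z ^ (- kap m) *: blk m (rev_ord m) qone))
  + \sum_(m < d | kap m == 0) blk m m qk.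

End Defs.

(* Main.v *)
Require Import Defs.
From HB Require Import structures.
From mathcomp Require Import all_boot all_order all_algebra perm.
From mathcomp Require Import sesquilinear spectral.
From mathcomp Require Import reals complex.
From mathcomp Require Import zify ring.
Set Implicit Arguments. Unset Strict Implicit. Unset Printing Implicit Defensive.
Import Order.TTheory GRing.Theory Num.Theory.
Local Open Scope ring_scope.

(* Write A = A_+ D A_- and let Q~ be the quaternionic conjugate of Q, so that the
   quaternionic matrices are the fixed points of ~.  By Liouville's theorem the plus
   factors of two factorizations of A differ by a polynomial matrix V whose entries
   satisfy deg V_ij <= k_i - k'_j; in particular V is block triangular with constant
   diagonal blocks.  Comparing A_+ with A_+~, a generic combination l A_+ + l^* A_+~
   is again a plus factor, and it is quaternionic.  Comparing A_+ with the plus factor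
   -A_-^dagger of -A^dagger = A shows that the partial indices are symmetric and that
   A = A_+ (V D^-1) A_+^dagger with deg V_ij <= k_i + k_j.  The entries of V with
   k_i + k_j = 0 form a constant matrix h, V h^-1 = 1 + x with x nilpotent, and
   g = sqrt(1 + x) satisfies V D^-1 = g (h D^-1) g^dagger.  Finally h is an invertible
   skew-Hermitian quaternionic matrix anticommuting with the grading by the indices,
   and any two such matrices are congruent by a matrix preserving the grading: after
   normalizing both to square to -1 by functional calculus, they are conjugate because
   skew-Hermitian quaternionic matrices have trace 0. *)

(** * Polynomial identities on the circle and an algebraic Liouville theorem *)

Section LaurentAlgebra.
Variable C : numClosedFieldType.
Implicit Types (p q : {poly C}) (z : C).

Lemma poly_eq0_inj p (f : nat -> C) :
  injective f -> (forall m, p.[f m] = 0) -> p = 0.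
Proof.
move=> f_inj pf; apply/eqP/negPn/negP => p0.
have := @max_poly_roots _ p [seq f i | i <- iota 0 (size p)] p0.
rewrite size_map size_iota ltnn map_inj_uniq ?iota_uniq // => /(_ _ isT) H.
by suff /H : all (root p) [seq f i | i <- iota 0 (size p)] by [];
  apply/allP => _ /mapP[i _ ->]; apply/rootP.
Qed.

Lemma poly_eq_nz p q : (forall z, z != 0 -> p.[z] = q.[z]) -> p = q.
Proof.
move=> pq; apply/eqP; rewrite -subr_eq0; apply/eqP.
apply: (@poly_eq0_inj _ (fun m => m.+1%:R)) => [m m' /eqP|m].
  by rewrite eqr_nat => /eqP[].
by rewrite hornerD hornerN pq ?subrr // pnatr_eq0.
Qed.

Lemma cayley_den_neq0 (m : nat) : 1 - 'i * m%:R != 0 :> C.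
Proof.
apply/eqP => h; have : (1 - 'i * m%:R) * (1 + 'i * m%:R) = 1 + (m ^ 2)%:R :> C.
  by rewrite -subr_sqr exprMn sqrCi expr1n natrX; ring.
by rewrite h mul0r => /esym/eqP; rewrite -(natrD _ 1) pnatr_eq0.
Qed.

Lemma conj_cayley (m : nat) : (1 - 'i * m%:R)^* = 1 + 'i * m%:R :> C.
Proof. by rewrite rmorphB rmorph1 rmorphM /= conjCi conjC_nat mulNr opprK. Qed.

Lemma poly_eq_circle p q : (forall z, `|z| = 1 -> p.[z] = q.[z]) -> p = q.
Proof.
move=> pq; apply/eqP; rewrite -subr_eq0; apply/eqP.
(* Cayley transforms of the natural numbers: infinitely many distinct points of the unit circle. *)
pose u (m : nat) : C := (1 + 'i * m%:R) / (1 - 'i * m%:R).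
apply: (@poly_eq0_inj _ u) => [m m'|m].
  rewrite /u => /eqP; rewrite eqr_div ?cayley_den_neq0 //.
  rewrite -subr_eq0 (_ : _ - _ = 2 * 'i * (m%:R - m'%:R)); last by ring.
  rewrite !mulf_eq0 pnatr_eq0 (negPf (neq0Ci _)) /= subr_eq0 eqr_nat.
  by move/eqP.
rewrite hornerD hornerN pq ?subrr // /u normf_div -conj_cayley norm_conjC divff //.
by rewrite normr_eq0 cayley_den_neq0.
Qed.

Definition revp m p : {poly C} := \poly_(i < m.+1) p`_(m - i).

Lemma horner_revp m p z : (size p <= m.+1)%N -> z != 0 ->
  (revp m p).[z] = z ^+ m * p.[z^-1].
Proof.
move=> sp z0; rewrite horner_poly (horner_coef_wide _ sp) mulr_sumr.
rewrite (reindex_inj rev_ord_inj) /=; apply: eq_bigr => i _.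
rewrite subSS subKn ?leq_ord // exprVn mulrCA expfB_cond ?(negPf z0) //=.
exact: leq_ord.
Qed.

(** Divisibility replaces complex analysis. After clearing negative powers, [b] divides [N] times
    the reversal of [c] times a power of z. The roots of [b] lie outside the closed disc, those of
    the other two factors inside, so [b] is coprime to them and divides [N] by Gauss's lemma.
    Comparing degrees then bounds the quotient. *)
Lemma liouville_poly (N b c M : {poly C}) (k : int) :
  (forall z, `|z| <= 1 -> b.[z] != 0) -> (forall z, `|z| <= 1 -> c.[z] != 0) ->
  (forall z, z != 0 -> N.[z] * c.[z^-1] = z ^ k * M.[z^-1] * b.[z]) ->
  exists v, N = v * b /\ forall m : nat, v`_m != 0 -> m%:Z <= k.
Proof.
move=> b0 c0 eqN.
(* The sign of [k] is unknown, so it is split as a' - a to keep both sides polynomial. *)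
have [a [a' [ka kaE]]] : exists a a' : nat, k = a'%:Z - a%:Z /\
    forall z, z != 0 -> z ^ k * z ^+ a = z ^+ a'.
  case: k {eqN} => k; [exists 0%N, k|exists k.+1, 0%N]; split; try lia; move=> z z0.
    by rewrite expr0 mulr1.
  by rewrite NegzE /= mulVf // expf_neq0.
pose m := (size c).-1; pose m' := (size M).-1.
have z01 : `|0 : C| <= 1 by rewrite normr0 ler01.
have bn0 : b != 0 by apply: contraTneq (b0 0 z01) => ->; rewrite horner0 eqxx.
have cn0 : c != 0 by apply: contraTneq (c0 0 z01) => ->; rewrite horner0 eqxx.
have szc : size c = m.+1 by rewrite /m prednK // size_poly_gt0.
have szM : (size M <= m'.+1)%N by exact: leqSpred.
have E : N * (revp m c * 'X^(m' + a)) = 'X^(m + a') * revp m' M * b.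
  apply: poly_eq_nz => z z0.
  rewrite !hornerM !hornerXn !horner_revp ?szc // !exprD -(kaE z z0).
  rewrite (_ : _ * _ = N.[z] * c.[z^-1] * (z ^+ m * z ^+ m' * z ^+ a)); last by ring.
  by rewrite eqN //; ring.
have cop : coprimep b (revp m c * 'X^(m' + a)).
  apply: Pdiv.ClosedField.root_coprimep => x /rootP bx.
  have x1 : 1 < `|x|.
    rewrite real_ltNge ?normr_real ?real1 //; apply/negP => /b0.
    by rewrite bx eqxx.
  have x0 : x != 0 by rewrite -normr_gt0 (lt_trans _ x1) ?ltr01.
  rewrite hornerM hornerXn horner_revp ?szc // !mulf_neq0 ?expf_neq0 // c0 //.
  by rewrite normrV ?unitfE // invf_le1 ?ltW // (lt_trans _ x1) ?ltr01.
have /dvdpP[v Nv] : b %| N.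
  by rewrite -(Gauss_dvdpl _ cop) E dvdp_mull.
exists v; split=> // j vj.
have vn0 : v != 0 by apply: contraNneq vj => ->; rewrite coef0.
have E2 : v * revp m c * 'X^(m' + a) = 'X^(m + a') * revp m' M.
  by apply: (mulIf bn0); rewrite -E Nv; ring.
(* Since c(0) is nonzero, the reversal of [c] has degree exactly [m], which the degree count for [v]
   requires. *)
have crm : (m < size (revp m c))%N.
  rewrite ltnNge; apply/negP => /(nth_default 0) /eqP.
  by rewrite coef_poly ltnSn subnn -horner_coef0 (negPf (c0 0 z01)).
have crn0 : revp m c != 0 by rewrite -size_poly_gt0 (leq_ltn_trans _ crm).
have jv : (j < size v)%N by rewrite ltnNge; apply: contra vj => /(nth_default 0) ->.
have szl : size (v * revp m c * 'X^(m' + a))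
    = ((size v + size (revp m c)).-1 + (m' + a).+1).-1.
  by rewrite size_Mmonic ?monicXn ?mulf_neq0 // size_polyXn size_mul.
have := size_polyMleq 'X^(m + a') (revp m' M).
have : (size (revp m' M) <= m'.+1)%N by exact: size_poly.
rewrite -E2 szl size_polyXn.
move: (size v) (size (revp m c)) (size (revp m' M)) crm jv => sv sc sM /=.
clear -ka; lia.
Qed.

End LaurentAlgebra.

(** * Matrix polynomials: comparing factorizations, indices and determinants *)

Section PolyMatrices.
Variables (C : numClosedFieldType) (n : nat).
Implicit Types (z : C) (M : 'M[{poly C}]_n) (k : 'I_n -> int).

Definition ev M z : 'M[C]_n := map_mx (horner_eval z) M.
Definition dz k z : 'M[C]_n := diag_mx (\row_i (z ^ k i)).

Lemma evE M z i j : ev M z i j = (M i j).[z]. Proof. by rewrite mxE. Qed.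
Lemma evM M N z : ev (M *m N) z = ev M z *m ev N z. Proof. exact: map_mxM. Qed.
Lemma evD M N z : ev (M + N) z = ev M z + ev N z. Proof. exact: map_mxD. Qed.
Lemma evN M z : ev (- M) z = - ev M z. Proof. exact: map_mxN. Qed.
Lemma ev1 z : ev 1%:M z = 1%:M. Proof. exact: map_mx1. Qed.
Lemma evC (A : 'M[C]_n) z : ev (map_mx polyC A) z = A.
Proof. by apply/matrixP => i j; rewrite !mxE /horner_eval hornerC. Qed.
Lemma ev_adj M z : ev (\adj M) z = \adj (ev M z). Proof. exact: map_mx_adj. Qed.
Lemma ev_det M z : \det (ev M z) = (\det M).[z]. Proof. exact: det_map_mx. Qed.
Lemma ev_scale p M z : ev (p *: M) z = p.[z] *: ev M z. Proof. exact: map_mxZ. Qed.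

Lemma ev_unit M z : (ev M z \in unitmx) = ((\det M).[z] != 0).
Proof. by rewrite unitmxE ev_det unitfE. Qed.

Lemma ev_eq_circle M N : (forall z, `|z| = 1 -> ev M z = ev N z) -> M = N.
Proof.
move=> MN; apply/matrixP => i j; apply: poly_eq_circle => z /MN /matrixP/(_ i j).
by rewrite !evE.
Qed.

Lemma mul_mx_dz (A : 'M[C]_n) k z i j : (A *m dz k z) i j = A i j * z ^ k j.
Proof. by rewrite mul_mx_diag !mxE. Qed.
Lemma mul_dz_mx (A : 'M[C]_n) k z i j : (dz k z *m A) i j = z ^ k i * A i j.
Proof. by rewrite mul_diag_mx !mxE. Qed.

Lemma dzVr k z : z != 0 -> dz k z *m dz (fun i => - k i) z = 1%:M.
Proof.
move=> z0; apply/matrixP => i j; rewrite mul_dz_mx !mxE.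
by case: eqP => [->|]; rewrite ?mulr0n ?mulr0 // !mulr1n -expfzDr // subrr expr0z.
Qed.
Lemma dzVl k z : z != 0 -> dz (fun i => - k i) z *m dz k z = 1%:M.
Proof. by move=> z0; apply: mulmx1C; exact: dzVr. Qed.

(* [Cp] and [Bp] differ by a polynomial factor
   because [Bp^-1 Cp = D_k Bm Cm^-1 D_k'^-1] is analytic both inside and outside
   the unit circle, up to the powers of [z] in [D_k] and [D_k']. *)
Lemma wiener_hopf_quotient (Bp Bm Cp Cm : 'M[{poly C}]_n) (k k' : 'I_n -> int) :
  (forall z, `|z| <= 1 -> ev Bp z \in unitmx) ->
  (forall z, `|z| <= 1 -> ev Cm z \in unitmx) ->
  (forall z, z != 0 ->
     ev Bp z *m dz k z *m ev Bm z^-1 = ev Cp z *m dz k' z *m ev Cm z^-1) ->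
  exists V : 'M[{poly C}]_n, Cp = Bp *m V /\
    forall i j (m : nat), (V i j)`_m != 0 -> m%:Z <= k i - k' j.
Proof.
move=> uB uC eqBC.
pose N := \adj Bp *m Cp; pose M := Bm *m \adj Cm.
(* Adjugates stand in for the inverses of [Bp] and [Cm], so each entry satisfies the hypothesis of
   [liouville_poly] with the two determinants as [b] and [c]. *)
have key i j z : z != 0 -> (N i j).[z] * (\det Cm).[z^-1] =
    z ^ (k i - k' j) * (M i j).[z^-1] * (\det Bp).[z].
  move=> z0; have /(congr1 (fun X => \adj (ev Bp z) *m X *m \adj (ev Cm z^-1))) := eqBC z z0.
  rewrite !mulmxA mul_adj_mx -!ev_adj -evM -/N -!mulmxA -evM -/M ev_adj mul_mx_adj.
  rewrite mul_scalar_mx mulmxA mul_mx_scalar.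
  move/matrixP/(_ i j); rewrite [LHS]mxE mul_dz_mx [RHS]mxE mul_mx_dz !evE !ev_det => E.
  have zk : z ^ k' j != 0 by rewrite expfz_neq0.
  apply: (mulIf zk); rewrite expfzDr //.
  rewrite [RHS](_ : _ = (\det Bp).[z] * (z ^ k i * (M i j).[z^-1])
    * (z ^ k' j * z ^ (- k' j))); last by ring.
  rewrite E -expfzDr // subrr expr0z; ring.
have ex ij : exists v, N ij.1 ij.2 = v * \det Bp /\
    forall m : nat, v`_m != 0 -> m%:Z <= k ij.1 - k' ij.2.
  apply: (@liouville_poly _ _ _ (\det Cm) (M ij.1 ij.2)) => z.
  - by move/uB; rewrite ev_unit.
  - by move/uC; rewrite ev_unit.
  - exact: key.
have [f Hf] := fin_all_exists ex.
(* The entries of adj(Bp) Cp divided by det Bp, that is, of Bp^-1 Cp. *)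
exists (\matrix_(i, j) f (i, j)); split; last first.
  by move=> i j m; rewrite mxE; case: (Hf (i, j)) => _; exact.
have b0 : \det Bp != 0.
  have := uB 0; rewrite normr0 ler01 ev_unit => /(_ isT).
  by apply: contraNneq => ->; rewrite horner0.
have : N = \det Bp *: \matrix_(i, j) f (i, j).
  by apply/matrixP => i j; rewrite !mxE mulrC; case: (Hf (i, j)) => /= <-; rewrite !mxE.
move/(congr1 (mulmx Bp)); rewrite mulmxA mul_mx_adj mul_scalar_mx -scalemxAr => E.
apply/matrixP => i j; apply: (mulfI b0).
by have /matrixP/(_ i j) := E; rewrite !mxE.
Qed.

(** Some term of the Leibniz expansion survives. *)
Lemma det_neq0_inj (K : comNzRingType) (M : 'M[K]_n) :
  \det M != 0 -> exists2 s : 'I_n -> 'I_n, injective s & forall i, M i (s i) != 0.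
Proof.
move=> d0; have [/existsP[s /forallP Hs]|/existsPn H] :=
  boolP [exists s : 'S_n, [forall i, M i (s i) != 0]].
  by exists s => //; exact: perm_inj.
case/eqP: d0; rewrite /determinant big1 // => s _.
have /forallPn[i /negPn/eqP Mi] := H s.
by rewrite (bigD1 i) //= Mi mul0r mulr0.
Qed.

(** Pigeonhole: were the sum negative at i, monotonicity would make [s] send the n - i indices from
    i on into the n - i - 1 indices below [rev_ord i]. *)
Lemma nonincreasing_match (k : 'I_n -> int) (s : 'I_n -> 'I_n) :
  (forall i j : 'I_n, (i <= j)%N -> k j <= k i) -> injective s ->
  (forall i, 0 <= k i + k (s i)) -> forall i, 0 <= k i + k (rev_ord i).
Proof.
move=> kd sI ks i; rewrite leNgt; apply/negP => ki.
have sub (i' : 'I_n) : (i <= i')%N -> (s i' < rev_ord i)%N.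
  move=> ii'; rewrite ltnNge; apply/negP => /kd h; have := ks i'.
  by have := kd _ _ ii'; lia.
have : (#|[set s x | x in [set x : 'I_n | (i <= x)%N]]| <= #|[set x : 'I_n | (x < rev_ord i)%N]|)%N.
  by apply/subset_leq_card/subsetP => _ /imsetP[x + ->]; rewrite !inE; exact: sub.
rewrite card_imset //.
have cA (m : nat) : (m <= n)%N -> #|[set x : 'I_n | (x < m)%N]| = m.
  move=> mn; rewrite cardsE -sum1_card.
  by rewrite -(big_ord_widen _ (fun=> 1%N)) // sum1_card card_ord.
rewrite cA; last by rewrite ltnW.
rewrite (_ : [set x : 'I_n | (i <= x)%N] = ~: [set x : 'I_n | (x < i)%N]); last first.
  by apply/setP => x; rewrite !inE leqNgt.
have := cardsC [set x : 'I_n | (x < i)%N]; rewrite cA ?(ltnW (ltn_ord i)) // card_ord /=.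
by move: #|_| => c; have := ltn_ord i; lia.
Qed.

(** The opposite inequality is the previous lemma for the sequence -k read backwards, which is again
    nonincreasing. *)
Lemma nonincreasing_match_sym (k : 'I_n -> int) (s t : 'I_n -> 'I_n) :
  (forall i j : 'I_n, (i <= j)%N -> k j <= k i) -> injective s -> injective t ->
  (forall i, 0 <= k i + k (s i)) -> (forall i, k i + k (t i) <= 0) ->
  forall i, k (rev_ord i) = - k i.
Proof.
move=> kd sI tI ks kt i.
have h1 := nonincreasing_match kd sI ks i.
have rI : injective (fun i => rev_ord (t (rev_ord i))).
  by move=> a b /rev_ord_inj/tI/rev_ord_inj.
have := @nonincreasing_match (fun i => - k (rev_ord i)) _ _ rI _ i.
rewrite rev_ordK => h2; suff : 0 <= - k (rev_ord i) - k i by lia.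
apply: h2 => [a b ab|a]; first by rewrite lerN2 kd //= leq_sub2l.
by rewrite rev_ordK; have := kt (rev_ord a); lia.
Qed.

(** Along any permutation the degree bounds add up to 0. Either all of them are 0 and the entries
    are constants, or one is negative and its entry vanishes; so only the constant matrix
    contributes. *)
Lemma det_degree_bound (V : 'M[{poly C}]_n) (a b : 'I_n -> int) :
  (forall i j (m : nat), (V i j)`_m != 0 -> m%:Z <= a i + b j) ->
  \sum_i a i + \sum_i b i = 0 ->
  \det V = (\det (\matrix_(i, j) if a i + b j == 0 then (V i j)`_0 else 0))%:P.
Proof.
move=> degV ab0; rewrite -det_map_mx /determinant; apply: eq_bigr => s _.
congr (_ * _).
have [/forallP s0|/forallPn/= [i si]] := boolP [forall i, a i + b (s i) == 0].
  apply: eq_bigr => i _; rewrite !mxE s0; apply/polyP => m; rewrite coefC.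
  case: m => //= m; apply/eqP; apply: contraTT isT => /degV.
  by rewrite (eqP (s0 i)).
have [i' si'] : exists i', a i' + b (s i') < 0.
  apply/existsP; apply: contraNT si; rewrite negb_exists => /forallP/= pos.
  have : \sum_i (a i + b (s i)) == 0.
    rewrite big_split /= [X in _ + X](_ : _ = \sum_i b i) ?ab0 //.
    by rewrite [RHS](reindex_inj (@perm_inj _ s)).
  rewrite psumr_eq0 => [/allP/(_ i)/=|j _]; first by apply; rewrite mem_index_enum.
  by rewrite leNgt.
rewrite (bigD1 i') //= [in RHS](bigD1 i') //= !mxE (lt_eqF si') mul0r.
rewrite (_ : V i' (s i') = 0) ?mul0r //; apply/polyP => m; rewrite coef0.
by apply/eqP; apply: contraTT si' => /degV; rewrite -leNgt; lia.
Qed.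

(** The determinant is a nonzero polynomial in the parameter, so some natural number is not a root.
    For natural [m] the two coefficients are conjugate to each other, which the averaging over
    quaternionic conjugation needs. *)
Lemma det_average_neq0 (X Y : 'M[C]_n) : \det X != 0 ->
  exists m : nat, \det ((1 + 'i * m%:R) *: X + (1 + 'i * m%:R)^* *: Y) != 0.
Proof.
move=> dX; pose P : {poly C} := \det ((1 + 'i *: 'X) *: map_mx polyC X
                                   + (1 - 'i *: 'X) *: map_mx polyC Y).
have PE z : P.[z] = \det ((1 + 'i * z) *: X + (1 - 'i * z) *: Y).
  by rewrite -ev_det evD !ev_scale !evC !hornerE.
have P0 : P != 0.
  (* At -i the coefficient of [Y] is 0 and that of [X] is 2. *)
  suff : P.[- 'i] != 0 by apply: contraNneq => ->; rewrite horner0.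
  rewrite PE mulrN -expr2 sqrCi opprK subrr scale0r addr0 detZ mulf_neq0 //.
  by rewrite expf_neq0 // -(natrD _ 1 1) pnatr_eq0.
have [/existsP [m Pm]|/existsPn H] := boolP [exists m : 'I_(size P), P.[m%:R] != 0].
  exists m; move: Pm; rewrite PE; congr (\det (_ + _ *: _) != 0).
  by rewrite rmorphD rmorph1 rmorphM /= conjCi conjC_nat mulNr.
have := @max_poly_roots _ P [seq m%:R | m <- iota 0 (size P)] P0.
rewrite size_map size_iota ltnn map_inj_uniq ?iota_uniq => [/(_ _ isT) h|m m' /eqP].
  suff /h : all (root P) [seq m%:R | m <- iota 0 (size P)] by [].
  apply/allP => _ /mapP[m + ->]; rewrite mem_iota /= => mP.
  by have := H (Ordinal mP); rewrite negbK /= => /eqP/rootP.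
by rewrite eqr_nat => /eqP.
Qed.

End PolyMatrices.

(** * Entrywise conjugation and adjoints *)

Section Adjoint.
Variables (C : numClosedFieldType) (n : nat).
Implicit Types (A B M : 'M[C]_n).

Lemma adjmE M i j : adjm M i j = (M j i)^*. Proof. by rewrite !mxE. Qed.
Lemma mconjE M i j : mconj M i j = (M i j)^*. Proof. by rewrite !mxE. Qed.
Lemma mconjM A B : mconj (A *m B) = mconj A *m mconj B. Proof. exact: map_mxM. Qed.
Lemma mconjD A B : mconj (A + B) = mconj A + mconj B. Proof. exact: map_mxD. Qed.
Lemma mconjN A : mconj (- A) = - mconj A. Proof. exact: map_mxN. Qed.
Lemma mconjZ c A : mconj (c *: A) = c^* *: mconj A. Proof. exact: map_mxZ. Qed.
Lemma mconj1 : mconj 1%:M = 1%:M :> 'M[C]_n. Proof. exact: map_mx1. Qed.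
Lemma mconjK A : mconj (mconj A) = A.
Proof. by apply/matrixP => i j; rewrite !mxE conjCK. Qed.
Lemma mconj_inv A : mconj (invmx A) = invmx (mconj A). Proof. exact: map_invmx. Qed.
Lemma mconj_unit A : (mconj A \in unitmx) = (A \in unitmx). Proof. exact: map_unitmx. Qed.

Lemma adjmM A B : adjm (A *m B) = adjm B *m adjm A.
Proof. by rewrite /adjm mconjM trmx_mul. Qed.
Lemma adjmD A B : adjm (A + B) = adjm A + adjm B.
Proof. by rewrite /adjm mconjD linearD. Qed.
Lemma adjmN A : adjm (- A) = - adjm A.
Proof. by rewrite /adjm mconjN linearN. Qed.
Lemma adjmZ c A : adjm (c *: A) = c^* *: adjm A.
Proof. by rewrite /adjm mconjZ linearZ. Qed.
Lemma adjm1 : adjm 1%:M = 1%:M :> 'M[C]_n. Proof. by rewrite /adjm mconj1 trmx1. Qed.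
Lemma adjmK A : adjm (adjm A) = A.
Proof. by apply/matrixP => i j; rewrite !adjmE conjCK. Qed.
Lemma adjm_inv A : adjm (invmx A) = invmx (adjm A).
Proof. by rewrite /adjm mconj_inv trmx_inv. Qed.
Lemma adjm_unit A : (adjm A \in unitmx) = (A \in unitmx).
Proof. by rewrite /adjm unitmx_tr mconj_unit. Qed.

Lemma comm_invmx A B : A \in unitmx -> A *m B = B *m A ->
  invmx A *m B = B *m invmx A.
Proof.
move=> uA AB; rewrite -[in RHS](mulKmx uA B) AB -!mulmxA mulmxV // mulmx1 //.
Qed.

End Adjoint.

(** * Functional calculus for positive matrices *)

Section FourthRoot.
Variables (C : numClosedFieldType) (n : nat).

(** A nonzero entry Y_ij forces equal eigenvalues m_i = m_j, so every function of the eigenvalues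
    inherits the intertwining relation. *)
Lemma diag_intertwine (m v : 'rV[C]_n) (Y : 'M[C]_n) :
  (forall i j, m 0 i = m 0 j -> v 0 i = v 0 j) ->
  diag_mx m *m Y = Y *m diag_mx m -> diag_mx v *m Y = Y *m diag_mx v.
Proof.
move=> mv; rewrite !mul_diag_mx !mul_mx_diag => /matrixP E.
apply/matrixP => i j; have := E i j; rewrite !mxE => {}E.
have [->|Y0] := eqVneq (Y i j) 0; first by rewrite mulr0 mul0r.
by rewrite mulrC (mv i j) //; apply: (mulIf Y0); rewrite E mulrC.
Qed.

Lemma similar_intertwine (m v : 'rV[C]_n) (P Q Y : 'M[C]_n) :
  P \in unitmx -> Q \in unitmx ->
  (forall i j, m 0 i = m 0 j -> v 0 i = v 0 j) ->
  invmx P *m diag_mx m *m P *m Y = Y *m (invmx Q *m diag_mx m *m Q) ->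
  invmx P *m diag_mx v *m P *m Y = Y *m (invmx Q *m diag_mx v *m Q).
Proof.
move=> uP uQ mv /(congr1 (fun X => P *m X *m invmx Q)).
rewrite !mulmxA mulmxV // mul1mx mulmxK // -!mulmxA => E.
have := @diag_intertwine m v (P *m Y *m invmx Q) mv.
rewrite !mulmxA in E *; move=> /(_ E) /(congr1 (fun X => invmx P *m X *m Q)).
by rewrite !mulmxA mulVmx // mul1mx mulmxKV.
Qed.

(** The root is taken on the eigenvalues of M M^dagger. A fourth root serves twice: its square is
    the positive part of a polar decomposition, and for skew-Hermitian M it is itself the square
    root of |M|. The last clause holds because the eigenvalues are real; it makes [b] quaternionic
    when [M] is. *)
Lemma positive_fourth_root (M : 'M[C]_n) :
  exists b : 'M[C]_n, [/\ b *m b *m b *m b = M *m adjm M, adjm b = b,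
    forall Y, M *m adjm M *m Y = Y *m (M *m adjm M) -> b *m Y = Y *m b &
    forall Y, M *m adjm M *m Y = Y *m mconj (M *m adjm M) -> b *m Y = Y *m mconj b].
Proof.
set r := M *m adjm M.
have adjE (A : 'M[C]_n) : (A ^t* )%sesqui = adjm A by rewrite /adjm /mconj map_trmx.
have rH : adjm r = r by rewrite /r adjmM adjmK.
have rN : r \is normalmx by apply/normalmxP; rewrite adjE rH.
have /orthomx_spectralP := rN; set P := spectralmx r; set m := spectral_diag r => rE.
have uP : P \in unitmx by exact: spectral_unit.
have PV : invmx P = adjm P by rewrite -adjE; apply: invmx_unitary; exact: spectral_unitarymx.
have m0 i : 0 <= m 0 i.
  have : (P *m M) *m adjm (P *m M) = diag_mx m.
    by rewrite adjmM mulmxA -(mulmxA P M) -/r rE !mulmxA mulmxV // mul1mx -PV mulmxK.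
  move/matrixP/(_ i i); rewrite [RHS]mxE eqxx mulr1n => <-.
  rewrite mxE; apply: sumr_ge0 => j _; rewrite adjmE; exact: mul_conjC_ge0.
pose v : 'rV[C]_n := \row_i 4.-root (m 0 i).
have mv i j : m 0 i = m 0 j -> v 0 i = v 0 j by rewrite !mxE => ->.
have diagconj (x : 'rV[C]_n) : (forall i, 0 <= x 0 i) -> mconj (diag_mx x) = diag_mx x.
  move=> x0; apply/matrixP => i j; rewrite !mxE.
  by rewrite rmorphMn /= geC0_conj.
have v0 i : 0 <= v 0 i by rewrite mxE rootC_ge0.
have cm := diagconj _ m0; have cv := diagconj _ v0.
exists (invmx P *m diag_mx v *m P); split.
- rewrite !mulmxA !mulmxK // rE -!(mulmxA (invmx P)) !mulmx_diag.
  congr (_ *m (diag_mx _ *m _)); apply/rowP => i; rewrite !mxE -[RHS](@rootCK _ 4) //.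
  by rewrite !exprS expr0 mulr1 !mulrA.
- by rewrite !adjmM adjm_inv -PV invmxK mulmxA {1}/adjm cv tr_diag_mx.
- move=> Y; rewrite {1 2}rE; exact: similar_intertwine.
- move=> Y; rewrite {1 2}rE !mconjM mconj_inv cm cv.
  by apply: similar_intertwine; rewrite ?mconj_unit.
Qed.

End FourthRoot.

(** * Equivalence of idempotents of equal trace *)

Section Idempotents.
Variables (C : numClosedFieldType) (n : nat).

Lemma idempotent_split (a : 'M[C]_n) : a *m a = a ->
  exists r : nat, \tr a = r%:R /\
    exists (c : 'M[C]_(n, r)) (d : 'M[C]_(r, n)), c *m d = a /\ d *m c = 1%:M.
Proof.
move=> aa; exists (\rank a).
have dc : row_base a *m col_base a = 1%:M.
  apply: (row_free_inj (row_base_free a)); apply: (row_full_inj (col_base_full a)).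
  by rewrite /= mul1mx mulmx_base -mulmxA mulmx_base mulmxA mulmx_base.
split; last by exists (col_base a), (row_base a); rewrite mulmx_base.
by rewrite -{1}(mulmx_base a) mxtrace_mulC dc mxtrace1.
Qed.

(** In characteristic 0 the trace determines the rank, so both idempotents factor through the same
    space; crossing the two factorizations gives [x] and [y]. *)
Lemma idempotent_equiv (a b : 'M[C]_n) : a *m a = a -> b *m b = b -> \tr a = \tr b ->
  exists x y, [/\ x *m y = a, y *m x = b, a *m x = x, x *m b = x & b *m y = y].
Proof.
move=> /idempotent_split[r [tra [c [d [cd dc]]]]] /idempotent_split[r' [trb H]].
rewrite tra trb => /eqP; rewrite eqr_nat => /eqP rr'; subst r'.
case: H => [c' [d' [cd' dc']]]; exists (c *m d'), (c' *m d); split.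
- by rewrite mulmxA -(mulmxA c) dc' mulmx1.
- by rewrite mulmxA -(mulmxA c') dc mulmx1.
- by rewrite -cd mulmxA -(mulmxA c) dc mulmx1.
- by rewrite -cd' mulmxA -(mulmxA c) dc' mulmx1.
- by rewrite -cd' mulmxA -(mulmxA c') dc' mulmx1.
Qed.

End Idempotents.

(** * Conjugating two graded complex structures *)

Section GradedIntertwiner.
Variables (C : numClosedFieldType) (n : nat).

(** Since c is i or -i, [a] is the projection onto the c-eigenspace of [s] inside the image of
    [o]. *)
Lemma half_eigenprojection (s o : 'M[C]_n) (c : C) :
  c * c = -1 -> s *m s = - 1%:M -> o *m o = o -> s *m o = o *m s ->
  let a := 2^-1 *: (o - c *: (o *m s)) in [/\ a *m a = a, s *m a = c *: a & a *m s = c *: a].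
Proof.
move=> cc ss oo so a.
have sa : s *m a = c *: a.
  rewrite -scalemxAr mulmxBr -scalemxAr mulmxA so -mulmxA ss mulmxN mulmx1 scalerA.
  rewrite mulrC -scalerA; congr (_ *: _).
  by rewrite scalerBr scalerA cc scaleN1r scalerN addrC !opprK.
have oa : o *m a = a by rewrite -scalemxAr mulmxBr -scalemxAr mulmxA oo.
have as_ : a *m s = s *m a.
  by rewrite -scalemxAl -scalemxAr mulmxBl mulmxBr -scalemxAl -scalemxAr mulmxA so.
split=> //; last by rewrite as_.
rewrite {1}/a -scalemxAl mulmxBl oa -scalemxAl -mulmxA sa -scalemxAr oa.
clearbody a; rewrite [c *: (c *: a)]scalerA cc scaleN1r opprK -mulr2n -scaler_nat.
by rewrite scalerA mulVf ?scale1r // pnatr_eq0.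
Qed.

(* The grading projections [p], [o], [q] onto the negative, zero and positive degrees
   are exchanged by [s] and [k].  On degree zero the two complex structures have
   eigenspaces of the same dimension because [o *m s] and [o *m k] are traceless. *)
Lemma graded_intertwiner (s k p o q g : 'M[C]_n) :
  s *m s = - 1%:M -> k *m k = - 1%:M ->
  p + o + q = 1%:M -> p *m p = p -> o *m o = o ->
  p *m o = 0 -> o *m p = 0 -> p *m q = 0 ->
  s *m p = q *m s -> k *m p = q *m k -> s *m o = o *m s -> k *m o = o *m k ->
  \tr (o *m s) = 0 -> \tr (o *m k) = 0 ->
  g *m o = 0 -> o *m g = 0 -> g *m p = p *m g ->
  s *m g = - (g *m s) -> k *m g = - (g *m k) ->
  exists X, [/\ X \in unitmx, s *m X = X *m k & g *m X = X *m g].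
Proof.
move=> ss kk sum1 pp oo po op pq sp kp so ko trs trk go og gp sg kg.
have ii : 'i * 'i = -1 :> C by rewrite -expr2 sqrCi.
have nii : (- 'i) * (- 'i) = -1 :> C by rewrite mulrNN ii.
have := half_eigenprojection ii ss oo so.
set a1 := _ *: _ => -[a1a1 sa1 a1s].
have := half_eigenprojection nii ss oo so.
set a2 := _ *: _ => -[a2a2 sa2 a2s].
have := half_eigenprojection ii kk oo ko.
set b1 := _ *: _ => -[b1b1 kb1 b1k].
have := half_eigenprojection nii kk oo ko.
set b2 := _ *: _ => -[b2b2 kb2 b2k].
have tr1 : \tr a1 = \tr b1 by rewrite /a1 /b1 !mxtraceZ !raddfB /= !mxtraceZ trs trk.
have tr2 : \tr a2 = \tr b2 by rewrite /a2 /b2 !mxtraceZ !raddfB /= !mxtraceZ trs trk.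
have [x1 [y1 [xy1 yx1 ax1 xb1 by1]]] := idempotent_equiv a1a1 b1b1 tr1.
have [x2 [y2 [xy2 yx2 ax2 xb2 by2]]] := idempotent_equiv a2a2 b2b2 tr2.
have a12 : a1 + a2 = o.
  rewrite /a1 /a2 -scalerDr scaleNr opprK addrACA addNr addr0.
  by rewrite -mulr2n -scaler_nat scalerA mulVf ?scale1r // pnatr_eq0.
have bo c : (2^-1 *: (o - c *: (o *m k))) *m g = 0.
  by rewrite -ko -scalemxAl mulmxBl -scalemxAl -mulmxA og mulmx0 scaler0 subrr scaler0.
have bp c : (2^-1 *: (o - c *: (o *m k))) *m p = 0.
  by rewrite -ko -scalemxAl mulmxBl -scalemxAl -mulmxA op mulmx0 scaler0 subrr scaler0.
have pb c : p *m (2^-1 *: (o - c *: (o *m k))) = 0.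
  by rewrite -scalemxAr mulmxBr -scalemxAr mulmxA po mul0mx scaler0 subrr scaler0.
have ga c : g *m (2^-1 *: (o - c *: (o *m s))) = 0.
  by rewrite -scalemxAr mulmxBr -scalemxAr mulmxA go mul0mx scaler0 subrr scaler0.
have [bg1 bg2] : b1 *m g = 0 /\ b2 *m g = 0 by split; exact: bo.
have [bp1 bp2] : b1 *m p = 0 /\ b2 *m p = 0 by split; exact: bp.
have [pb1 pb2] : p *m b1 = 0 /\ p *m b2 = 0 by split; exact: pb.
have [ga1 ga2] : g *m a1 = 0 /\ g *m a2 = 0 by split; exact: ga.
clear tr1 tr2; clearbody a1 a2 b1 b2.
have b12 : b1 *m b2 = 0.
  have : b1 *m (k *m b2) = b1 *m k *m b2 by rewrite mulmxA.
  rewrite kb2 b1k -scalemxAr -scalemxAl scaleNr => /eqP.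
  rewrite eq_sym -addr_eq0 -mulr2n -scaler_nat scalerA.
  by rewrite scaler_eq0 mulf_eq0 pnatr_eq0 (negPf (neq0Ci _)) => /eqP.
have b21 : b2 *m b1 = 0.
  have : b2 *m (k *m b1) = b2 *m k *m b1 by rewrite mulmxA.
  rewrite kb1 b2k -scalemxAr -scalemxAl scaleNr => /eqP.
  rewrite -addr_eq0 -mulr2n -scaler_nat scalerA.
  by rewrite scaler_eq0 mulf_eq0 pnatr_eq0 (negPf (neq0Ci _)) => /eqP.
(* Identity on negative degrees, transported to positive degrees as s p k^-1 with k^-1 = -k, and a
   matching of eigenspaces in degree zero. The inverse [Y] exchanges the roles of [s] and [k]. *)
pose X := p - s *m p *m k + (x1 + x2).
pose Y := p - k *m p *m s + (y1 + y2).
have xk1 : x1 *m k = 'i *: x1 by rewrite -{1}xb1 -mulmxA b1k -scalemxAr xb1.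
have xk2 : x2 *m k = - 'i *: x2 by rewrite -{1}xb2 -mulmxA b2k -scalemxAr xb2.
have xp1 : x1 *m p = 0 by rewrite -xb1 -mulmxA bp1 mulmx0.
have xp2 : x2 *m p = 0 by rewrite -xb2 -mulmxA bp2 mulmx0.
have py1 : p *m y1 = 0 by rewrite -by1 mulmxA pb1 mul0mx.
have py2 : p *m y2 = 0 by rewrite -by2 mulmxA pb2 mul0mx.
have xy12 : x1 *m y2 = 0 by rewrite -xb1 -by2 mulmxA -(mulmxA x1) b12 mulmx0 mul0mx.
have xy21 : x2 *m y1 = 0 by rewrite -xb2 -by1 mulmxA -(mulmxA x2) b21 mulmx0 mul0mx.
have ky1 : k *m y1 = 'i *: y1 by rewrite -{1}by1 mulmxA kb1 -scalemxAl by1.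
have ky2 : k *m y2 = - 'i *: y2 by rewrite -{1}by2 mulmxA kb2 -scalemxAl by2.
have XY : X *m Y = 1%:M.
  have E0 : (x1 + x2) *m (y1 + y2) = o.
    by rewrite mulmxDl !mulmxDr xy1 xy2 xy12 xy21 addr0 add0r.
  have E1 : (p - s *m p *m k) *m (y1 + y2) = 0.
    rewrite mulmxBl mulmxDr py1 py2 addr0 -(mulmxA _ k) mulmxDr ky1 ky2.
    by rewrite -mulmxA mulmxDr -!scalemxAr py1 py2 !scaler0 addr0 mulmx0 subrr.
  have E2 : (x1 + x2) *m (p - k *m p *m s) = 0.
    rewrite mulmxBr mulmxDl xp1 xp2 addr0 !mulmxA mulmxDl xk1 xk2.
    by rewrite mulmxDl -!scalemxAl xp1 xp2 !scaler0 addr0 mul0mx subrr.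
  have E3 : (p - s *m p *m k) *m (p - k *m p *m s) = p + q.
    rewrite mulmxBl !mulmxBr pp.
    have -> : p *m (k *m p *m s) = 0 by rewrite kp !mulmxA pq !mul0mx.
    have -> : s *m p *m k *m p = 0 by rewrite -mulmxA kp mulmxA -(mulmxA s) pq mulmx0 mul0mx.
    have -> : s *m p *m k *m (k *m p *m s) = q.
      rewrite !mulmxA -(mulmxA _ k k) kk mulmxN mulmx1 !mulNmx -(mulmxA s) pp sp.
      by rewrite -mulmxA ss mulmxN opprK mulmx1.
    by rewrite subr0 sub0r opprK.
  by rewrite /X /Y mulmxDl 2!(mulmxDr _ (p - _) (y1 + y2)) E0 E1 E2 E3 addr0 add0r -sum1 addrAC.
exists X; split; first by case: (mulmx1_unit XY).
- have e1 : s *m (p - s *m p *m k) = (p - s *m p *m k) *m k.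
    rewrite mulmxBr mulmxBl !mulmxA ss !mulNmx mul1mx -(mulmxA (s *m p)) kk.
    by rewrite mulmxN mulmx1 !opprK addrC.
  rewrite /X mulmxDr mulmxDl e1; congr (_ + _).
  by rewrite mulmxDr mulmxDl xk1 xk2 -{1}ax1 -{1}ax2 !mulmxA sa1 sa2 -!scalemxAl ax1 ax2.
- have gx1 : g *m x1 = 0 by rewrite -ax1 mulmxA ga1 mul0mx.
  have gx2 : g *m x2 = 0 by rewrite -ax2 mulmxA ga2 mul0mx.
  have xg1 : x1 *m g = 0 by rewrite -xb1 -mulmxA bg1 mulmx0.
  have xg2 : x2 *m g = 0 by rewrite -xb2 -mulmxA bg2 mulmx0.
  rewrite /X mulmxDr mulmxDl mulmxBr mulmxBl !(mulmxDr g x1) !(mulmxDl x1) gx1 gx2 xg1 xg2 gp.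
  congr (_ - _ + _); rewrite -(mulmxA _ k g).
  have -> : k *m g = - (g *m k) by [].
  rewrite mulmxN !mulmxA -(mulmxA s p g) -gp !mulmxA sg !mulNmx opprK.
  by [].
Qed.

End GradedIntertwiner.

(** * Matrices preserving or reversing the grading by the indices *)

Section Grading.
Variables (C : numClosedFieldType) (n : nat) (k : 'I_n -> int).
Implicit Types (M : 'M[C]_n) (f g : int -> C).

Definition homogeneous M := forall i j, M i j != 0 -> k i = k j.
Definition antihomogeneous M := forall i j, M i j != 0 -> k i = - k j.
Definition dg f : 'M[C]_n := diag_mx (\row_i f (k i)).

Lemma mul_mx_dg M f i j : (M *m dg f) i j = M i j * f (k j).
Proof. by rewrite mul_mx_diag !mxE. Qed.
Lemma mul_dg_mx M f i j : (dg f *m M) i j = f (k i) * M i j.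
Proof. by rewrite mul_diag_mx !mxE. Qed.

Lemma dgM f g : dg f *m dg g = dg (fun x => f x * g x).
Proof. by rewrite mulmx_diag; congr diag_mx; apply/rowP => i; rewrite !mxE. Qed.

Lemma eq_dg f g : f =1 g -> dg f = dg g.
Proof. by move=> fg; congr diag_mx; apply/rowP => i; rewrite !mxE fg. Qed.

Lemma homogeneous_dg M f : homogeneous M -> M *m dg f = dg f *m M.
Proof.
move=> hM; apply/matrixP => i j; rewrite mul_mx_dg mul_dg_mx mulrC.
by have [->|/hM->//] := eqVneq (M i j) 0; rewrite !mulr0.
Qed.

Lemma antihomogeneous_dg M f : antihomogeneous M -> M *m dg f = dg (f \o -%R) *m M.
Proof.
move=> hM; apply/matrixP => i j; rewrite mul_mx_dg mul_dg_mx mulrC /=.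
by have [->|/hM->] := eqVneq (M i j) 0; rewrite ?mulr0 // opprK.
Qed.

(** The degree operator [dg intr] separates degrees because the integers embed in C. Phrased as
    commutation with it, homogeneity passes through functional calculus. *)
Lemma homogeneousP M : dg intr *m M = M *m dg intr -> homogeneous M.
Proof.
move=> E i j Mij; have /matrixP/(_ i j) := E; rewrite mul_mx_dg mul_dg_mx mulrC.
by move/(mulfI Mij)/intr_inj.
Qed.

Lemma antihomogeneousP M : dg intr *m M = - (M *m dg intr) -> antihomogeneous M.
Proof.
move=> E i j Mij; have /matrixP/(_ i j) := E; rewrite [RHS]mxE mul_mx_dg mul_dg_mx mulrC.
by rewrite -mulrN -mulrNz => /(mulfI Mij)/intr_inj.
Qed.

Lemma antihomogeneous_dgN M : antihomogeneous M -> M *m dg intr = - (dg intr *m M).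
Proof.
move=> hM; rewrite antihomogeneous_dg // -mulNmx; congr (_ *m _).
by apply/matrixP => i j; rewrite !mxE /= mulrNz mulNrn.
Qed.

Lemma homogeneous_adjm M : homogeneous M -> homogeneous (adjm M).
Proof. by move=> hM i j; rewrite adjmE conjC_eq0 => /hM. Qed.

Lemma adjm_dg f : (forall x, (f x)^* = f x) -> adjm (dg f) = dg f.
Proof.
move=> fr; apply/matrixP => i j; rewrite adjmE !mxE eq_sym.
by case: eqP => [->|]; rewrite ?mulr1n ?mulr0n ?fr ?rmorph0.
Qed.

Lemma mconj_dg f : mconj (dg f) = dg (fun x => (f x)^*).
Proof. by apply/matrixP => i j; rewrite !mxE rmorphMn. Qed.

End Grading.

(** * Quaternionic conjugation and skew-Hermitian normal forms *)

Section Quaternionic.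
Variables (C : numClosedFieldType) (n : nat) (S : 'M[C]_n).
Hypotheses (SS : S *m S = 1%:M) (Sc : mconj S = - S) (Sa : adjm S = S).
Implicit Types A B M : 'M[C]_n.

(** For [S = Sy] this is the conjugation whose fixed points are the quaternionic matrices; only the
    algebraic properties of [S] are used. *)
Definition qc M : 'M[C]_n := S *m mconj M *m S.

Lemma qcM A B : qc (A *m B) = qc A *m qc B.
Proof.
by rewrite /qc mconjM !mulmxA -[_ *m S *m S in RHS]mulmxA SS mulmx1.
Qed.
Lemma qcD A B : qc (A + B) = qc A + qc B.
Proof. by rewrite /qc mconjD mulmxDr mulmxDl. Qed.
Lemma qcZ c A : qc (c *: A) = c^* *: qc A.
Proof. by rewrite /qc mconjZ -scalemxAr -scalemxAl. Qed.
Lemma qc_sum (I : Type) (r : seq I) (F : I -> 'M[C]_n) :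
  qc (\sum_(i <- r) F i) = \sum_(i <- r) qc (F i).
Proof.
apply: (big_morph qc qcD).
by rewrite /qc /mconj map_mx0 mulmx0 mul0mx.
Qed.
Lemma qc1 : qc 1%:M = 1%:M.
Proof. by rewrite /qc mconj1 mulmx1 SS. Qed.
Lemma qcK A : qc (qc A) = A.
Proof.
rewrite /qc !mconjM mconjK Sc !(mulmxN, mulNmx) opprK !mulmxA SS mul1mx.
by rewrite -mulmxA SS mulmx1.
Qed.
Lemma qc_adjm A : qc (adjm A) = adjm (qc A).
Proof.
rewrite /qc !adjmM Sa mulmxA; congr (_ *m _ *m _).
by apply/matrixP => i j; rewrite !mxE.
Qed.
Lemma qc_inv A : A \in unitmx -> qc (invmx A) = invmx (qc A).
Proof.
move=> uA; have E : qc A *m qc (invmx A) = 1%:M by rewrite -qcM mulmxV // qc1.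
have [uqA _] := mulmx1_unit E.
by rewrite -[LHS](mulKmx uqA) E mulmx1.
Qed.
Lemma qc_unit A : A \in unitmx -> qc A \in unitmx.
Proof.
move=> uA; have E : qc A *m qc (invmx A) = 1%:M by rewrite -qcM mulmxV // qc1.
by case: (mulmx1_unit E).
Qed.
(** Being quaternionic becomes an intertwining relation with [S], the form handled by
    [positive_fourth_root]. *)
Lemma qc_fix_comm A : qc A = A <-> A *m S = S *m mconj A.
Proof.
rewrite /qc; split=> [E|<-]; last by rewrite -mulmxA SS mulmx1.
by rewrite -{1}E -mulmxA SS mulmx1.
Qed.

Lemma average_qc_fixed X : X \in unitmx -> exists l : C,
  let e := l *: X + l^* *: qc X in e \in unitmx /\ qc e = e.
Proof.
rewrite unitmxE unitfE => /(det_average_neq0 (qc X))[m dm].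
exists (1 + 'i * m%:R) => e; split; first by rewrite unitmxE unitfE.
by rewrite /e qcD !qcZ qcK conjCK addrC.
Qed.

Variable k : 'I_n -> int.
Hypothesis Sk : homogeneous k S.

Lemma qc_dg f : (forall x, (f x)^* = f x) -> qc (dg k f) = dg k f.
Proof.
move=> fr; rewrite /qc mconj_dg (eq_dg k fr) homogeneous_dg // -mulmxA SS.
by rewrite mulmx1.
Qed.

(** Skew-Hermitian makes the trace imaginary, quaternionic makes it real. *)
Lemma skew_qc_traceless M (f : int -> C) : (forall x, (f x)^* = f x) ->
  adjm M = - M -> qc M = M -> \tr (dg k f *m M) = 0.
Proof.
move=> fr Ma Mq; set o := dg k f; set t := \tr _.
have tc A : (\tr A)^* = \tr (mconj A) by rewrite -trace_map_mx.
have t1 : t^* = - t.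
  rewrite tc -mxtrace_tr -/(adjm _) adjmM Ma (adjm_dg _ fr) mulNmx raddfN /=.
  by rewrite mxtrace_mulC.
have t2 : t^* = t.
  by rewrite tc /t /o -[in RHS](qc_dg fr) -[in RHS]Mq -qcM /qc mxtrace_mulC mulmxA SS mul1mx.
apply/eqP; move/eqP: t1; rewrite t2 -addr_eq0 -mulr2n -mulr_natl mulf_eq0.
by rewrite pnatr_eq0.
Qed.

Lemma skew_qc_congruent (h j : 'M[C]_n) :
  adjm h = - h -> qc h = h -> antihomogeneous k h -> h \in unitmx ->
  adjm j = - j -> qc j = j -> antihomogeneous k j -> j *m j = - 1%:M ->
  exists w, [/\ w *m j *m adjm w = h, qc w = w, homogeneous k w & w \in unitmx].
Proof.
move=> ha hq hk hu ja jq jk jj.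
pose g := dg k (intr : int -> C).
have ir (x : int) : (x%:~R : C)^* = x%:~R by rewrite rmorph_int.
have ga : adjm g = g by apply: adjm_dg; exact: ir.
have gq : qc g = g by apply: qc_dg; exact: ir.
have hg : h *m g = - (g *m h) by exact: antihomogeneous_dgN.
have jg : j *m g = - (g *m j) by exact: antihomogeneous_dgN.
have qr A : qc A = A -> A *m adjm A *m S = S *m mconj (A *m adjm A).
  by move=> qA; apply/qc_fix_comm; rewrite qcM qc_adjm qA.
have [b [b4 ba bc bS]] := positive_fourth_root h.
have bq : qc b = b by apply/qc_fix_comm/bS/qr.
have bh : b *m h = h *m b by apply: bc; rewrite ha !(mulmxN, mulNmx) mulmxA.
have bg : b *m g = g *m b.
  apply: bc; rewrite ha !(mulmxN, mulNmx) -(mulmxA h h g) hg mulmxN (mulmxA h g h) hg.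
  by rewrite mulNmx opprK mulmxA.
have bu : b \in unitmx.
  have : b *m (b *m b *m b *m invmx (h *m adjm h)) = 1%:M.
    by rewrite !mulmxA b4 mulmxV // unitmx_mul adjm_unit hu.
  by case/mulmx1_unit.
pose bi := invmx b; have bbi : b *m bi = 1%:M by exact: mulmxV.
have bih : bi *m h = h *m bi by exact: comm_invmx.
have big : bi *m g = g *m bi by exact: comm_invmx.
have bia : adjm bi = bi by rewrite /bi adjm_inv ba.
have biq : qc bi = bi by rewrite /bi qc_inv // bq.
(* As b^4 = h h^dagger = -h^2 and b commutes with h, this normalizes h to square -1. *)
pose s := bi *m h *m bi.
have bsb : b *m s *m b = h.
  by rewrite /s !mulmxA bbi mul1mx -mulmxA (mulmx1C bbi) mulmx1.
have ss : s *m s = - 1%:M.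
  have hh : h *m h = - (b *m b *m b *m b) by rewrite b4 ha mulmxN opprK.
  have sE : s = h *m (bi *m bi) by rewrite /s bih mulmxA.
  have ch : bi *m bi *m h = h *m (bi *m bi) by rewrite -mulmxA bih mulmxA bih mulmxA.
  rewrite sE mulmxA -(mulmxA h _ h) ch (mulmxA h h) hh !mulmxA !mulNmx.
  by rewrite !mulmxK // bbi.
have sa : adjm s = - s by rewrite /s !adjmM bia ha mulNmx mulmxN mulmxA.
have sq : qc s = s by rewrite /s !qcM biq hq.
have sg : s *m g = - (g *m s).
  by rewrite /s -mulmxA big mulmxA -(mulmxA bi) hg mulmxN mulmxA big !mulNmx !mulmxA.
have sk : antihomogeneous k s by apply: antihomogeneousP; rewrite -/g sg opprK.
clearbody s; pose p := dg k (fun x : int => (x < 0)%R%:R : C).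
pose q := dg k (fun x : int => (0 < x)%R%:R : C).
pose o := dg k (fun x : int => (x == 0)%:R : C).
have dgE0 (f : int -> C) : (forall x, f x = 0) -> dg k f = 0.
  by move=> f0; apply/matrixP => i i'; rewrite !mxE f0 mul0rn.
have [X [Xu sX gX]] : exists X, [/\ X \in unitmx, s *m X = X *m j & g *m X = X *m g].
  apply: (@graded_intertwiner _ _ s j p o q g) => //.
  - apply/matrixP => i i'; rewrite !mxE -!mulrnDl -!natrD.
    by case: (ltrgt0P (k i)) => _; case: eqP.
  - by rewrite dgM; apply: eq_dg => x; rewrite -natrM mulnb andbb.
  - by rewrite dgM; apply: eq_dg => x; rewrite -natrM mulnb andbb.
  - by rewrite dgM; apply: dgE0 => x; rewrite -natrM mulnb; case: ltrgt0P.
  - by rewrite dgM; apply: dgE0 => x; rewrite -natrM mulnb; case: ltrgt0P.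
  - by rewrite dgM; apply: dgE0 => x; rewrite -natrM mulnb; case: ltrgt0P.
  - rewrite antihomogeneous_dg //; congr (_ *m _); apply: eq_dg => x /=.
    by rewrite oppr_lt0.
  - rewrite antihomogeneous_dg //; congr (_ *m _); apply: eq_dg => x /=.
    by rewrite oppr_lt0.
  - rewrite antihomogeneous_dg //; congr (_ *m _); apply: eq_dg => x /=.
    by rewrite oppr_eq0.
  - rewrite antihomogeneous_dg //; congr (_ *m _); apply: eq_dg => x /=.
    by rewrite oppr_eq0.
  - by apply: skew_qc_traceless => // x; rewrite conjC_nat.
  - by apply: skew_qc_traceless => // x; rewrite conjC_nat.
  - by rewrite dgM; apply: dgE0 => x; case: eqP => [->|]; rewrite ?mulr0 ?mul0r.
  - by rewrite dgM; apply: dgE0 => x; case: eqP => [->|]; rewrite ?mulr0 ?mul0r.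
  - by rewrite !dgM; apply: eq_dg => x; rewrite mulrC.
(* The average still intertwines, because [s], [j] and [g] are themselves quaternionic. *)
have [l] := average_qc_fixed Xu; set e := _ + _ => -[eu eq].
have se : s *m e = e *m j.
  have sX' : s *m qc X = qc X *m j by rewrite -{1}sq -qcM sX qcM jq.
  by rewrite /e mulmxDr mulmxDl -!scalemxAr -!scalemxAl sX sX'.
have ge : g *m e = e *m g.
  have gX' : g *m qc X = qc X *m g by rewrite -{1}gq -qcM gX qcM gq.
  by rewrite /e mulmxDr mulmxDl -!scalemxAr -!scalemxAl gX gX'.
clearbody e.
have es : adjm e *m s = j *m adjm e.
  have := congr1 (@adjm C n) se; rewrite !adjmM sa ja mulmxN mulNmx.
  by move/oppr_inj.
have eg : adjm e *m g = g *m adjm e by rewrite -{1}ga -adjmM ge adjmM ga.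
(* Polar decomposition: c^-2 e is unitary and still intertwines [s] and [j], since [c] commutes with
   [s] and [g]. *)
have [c [c4 ca cc cS]] := positive_fourth_root e.
have cq : qc c = c by apply/qc_fix_comm/cS/qr.
have cs : c *m s = s *m c by apply: cc; rewrite -mulmxA es !mulmxA se.
have cg : c *m g = g *m c by apply: cc; rewrite -mulmxA eg !mulmxA ge.
have cu : c \in unitmx.
  have : c *m (c *m c *m c *m invmx (e *m adjm e)) = 1%:M.
    by rewrite !mulmxA c4 mulmxV // unitmx_mul adjm_unit eu.
  by case/mulmx1_unit.
pose ci := invmx c.
have cig : ci *m g = g *m ci by exact: comm_invmx.
have cis : ci *m s = s *m ci by exact: comm_invmx.
(* The unitary c^-2 e carries [j] to [s], and b s b = h. *)
exists (b *m ci *m ci *m e); split.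
- have -> : adjm (b *m ci *m ci *m e) = adjm e *m ci *m ci *m b.
    by rewrite !adjmM ba /ci adjm_inv ca !mulmxA.
  rewrite !mulmxA -(mulmxA _ e j) -se !mulmxA -(mulmxA _ e (adjm e)) -c4.
  rewrite -(mulmxA _ ci s) cis !mulmxA -(mulmxA _ ci s) cis !mulmxA.
  by rewrite /ci mulmxKV // mulmxKV // mulmxK // mulmxK // bsb.
- by rewrite !qcM bq eq /ci qc_inv // cq.
- apply: homogeneousP; rewrite -/g !mulmxA -bg -(mulmxA _ g ci) -cig !mulmxA.
  by rewrite -(mulmxA _ g ci) -cig !mulmxA -(mulmxA _ g e) ge !mulmxA.
- by rewrite !unitmx_mul bu /ci unitmx_inv cu.
Qed.

End Quaternionic.

(** * Making the plus factor quaternionic *)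

Section QuaternionicFactorization.
Variables (C : numClosedFieldType) (n : nat) (S : 'M[C]_n) (k : 'I_n -> int).
Hypotheses (SS : S *m S = 1%:M) (Sc : mconj S = - S) (Sa : adjm S = S).
Hypothesis Sk : homogeneous k S.
Local Notation qc := (qc S).
Implicit Types (z : C) (M : 'M[{poly C}]_n).

Definition conjp M : 'M[{poly C}]_n := map_mx (map_poly (@Num.conj C)) M.
(** Only the coefficients are conjugated, so the result is polynomial in z; the dagger of M at z is
    [ev (adjp M) z^-1]. *)
Definition adjp M : 'M[{poly C}]_n := (conjp M)^T.
Definition qcp M : 'M[{poly C}]_n := map_mx polyC S *m conjp M *m map_mx polyC S.
Definition invertible_on_disc M := forall z, `|z| <= 1 -> ev M z \in unitmx.

Lemma ev_conjp M z : ev (conjp M) z = mconj (ev M z^*).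
Proof.
apply/matrixP => i j; rewrite evE mconjE evE mxE.
by rewrite -[z in LHS]conjCK horner_map.
Qed.

Lemma ev_adjp M z : ev (adjp M) z = adjm (ev M z^*).
Proof.
have := ev_conjp M z => /matrixP E; apply/matrixP => i j.
by have := E j i; rewrite adjmE mconjE => <-; rewrite !evE mxE.
Qed.

Lemma ev_qcp M z : ev (qcp M) z = qc (ev M z^*).
Proof. by rewrite /qcp !evM !evC ev_conjp. Qed.

Lemma norm_le1_conj z : (`|z^*| <= 1) = (`|z| <= 1).
Proof. by rewrite norm_conjC. Qed.

Lemma dz_inv (kk : 'I_n -> int) z : dz kk z^-1 = dz (fun i => - kk i) z.
Proof.
by apply/matrixP => i j; rewrite !mxE -exprz_inv.
Qed.

Lemma dz_conj (kk : 'I_n -> int) z : mconj (dz kk z) = dz kk z^*.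
Proof. by apply/matrixP => i j; rewrite !mxE rmorphMn /= fmorphXz. Qed.

Lemma adjm_dz (kk : 'I_n -> int) z : adjm (dz kk z) = dz kk z^*.
Proof. by rewrite /adjm dz_conj tr_diag_mx. Qed.

Lemma qc_dz z : qc (dz k z^*) = dz k z.
Proof.
rewrite /qc dz_conj conjCK -[dz k z]/(dg k (fun x => z ^ x)) homogeneous_dg //.
by rewrite -mulmxA SS mulmx1.
Qed.

Lemma qc_dzN z : qc (dz (fun i => - k i) z^*) = dz (fun i => - k i) z.
Proof.
rewrite /qc dz_conj conjCK -[dz _ z]/(dg k (fun x => z ^ - x)) homogeneous_dg //.
by rewrite -mulmxA SS mulmx1.
Qed.

Lemma unit_circle_conj z : `|z| = 1 -> z^* = z^-1.
Proof.
by move=> z1; rewrite invC_norm z1 expr1n invr1 mul1r.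
Qed.

(* Conjugating a lower triangular [W] of controlled degrees by the diagonal factor
   turns it into a polynomial in [z^-1]. *)
Lemma degree_bound_reverse (W : 'M[{poly C}]_n) :
  (forall i j (m : nat), (W i j)`_m != 0 -> m%:Z <= k i - k j) ->
  exists G : 'M[{poly C}]_n, forall w, w != 0 ->
    ev G w = dz k w *m ev W w^-1 *m dz (fun i => - k i) w.
Proof.
move=> degW; exists (\matrix_(i, j) revp `|k i - k j|%N (W i j)) => w w0.
apply/matrixP => i j; rewrite evE mxE mul_mx_dz mul_dz_mx evE.
have sz : (size (W i j) <= `|k i - k j|%N.+1)%N.
  apply/leq_sizeP => m mk; apply/eqP; apply: contraTT mk => /degW; lia.
rewrite horner_revp // mulrAC -expfzDr //.
have [->|/eqP W0] := eqVneq (W i j) 0; first by rewrite horner0 !mulr0.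
have [m Wm] : exists m, (W i j)`_m != 0.
  by exists (size (W i j)).-1; rewrite -lead_coefE lead_coef_eq0; apply/eqP.
by have := degW _ _ _ Wm => h; rewrite exprnP gez0_abs //; lia.
Qed.

(** Averaging replaces A_+ by A_+ W. The minus factor absorbs W^-1, because D^-1 W D is a polynomial
    in z^-1 with nonzero constant determinant. *)
Lemma quaternionic_factor (F : C -> 'M[C]_n) (Ap Am : 'M[{poly C}]_n) :
  invertible_on_disc Ap -> invertible_on_disc Am ->
  (forall z, z != 0 -> qc (F z^*) = F z) ->
  (forall z, z != 0 -> F z = ev Ap z *m dz k z *m ev Am z^-1) ->
  exists Bp Bm, [/\ invertible_on_disc Bp, invertible_on_disc Bm, qcp Bp = Bp &
    forall z, z != 0 -> F z = ev Bp z *m dz k z *m ev Bm z^-1].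
Proof.
move=> uAp uAm Fq FA.
have uq M : invertible_on_disc M -> invertible_on_disc (qcp M).
  by move=> uM z z1; rewrite ev_qcp qc_unit // uM // norm_le1_conj.
have [|V [VE degV]] := @wiener_hopf_quotient C n Ap Am (qcp Ap) (qcp Am) k k uAp (uq _ uAm).
  move=> z z0; rewrite -FA // -Fq // FA ?conjC_eq0 // !qcM // qc_dz !ev_qcp.
  by rewrite fmorphV.
have d1 : \det (1%:M : 'M[C]_n) != 0 by rewrite det1 oner_eq0.
(* Working at z = 0 is enough: the degree bound makes det W constant. *)
have [m] := det_average_neq0 (ev V 0) d1; set l : C := 1 + _ => dm.
pose W : 'M[{poly C}]_n := l%:P *: 1%:M + (l^*)%:P *: V.
have evW z : ev W z = l *: 1%:M + l^* *: ev V z by rewrite evD !ev_scale ev1 !hornerC.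
have degW i j (r : nat) : (W i j)`_r != 0 -> r%:Z <= k i - k j.
  rewrite !mxE coefD !coefCM; have [/degV h _ //|] := boolP ((V i j)`_r != 0).
  move=> /negPn/eqP->; rewrite mulr0 addr0.
  have [->|_] := eqVneq i j; last by rewrite mulr0n coef0 mulr0 eqxx.
  by rewrite coef1; case: r => [|r]; rewrite ?subrr // mulr0 eqxx.
have sum0 : \sum_i k i + \sum_i - k i = 0 by rewrite sumrN subrr.
have [d d0 dW] : exists2 d, d != 0 & \det W = d%:P.
  have dE := det_degree_bound degW sum0; exists (\det W).[0]; last by rewrite dE hornerC.
  by rewrite -ev_det evW.
have [G GE] := degree_bound_reverse degW.
have dG : \det G = d%:P.
  apply: poly_eq_nz => w w0; rewrite -ev_det GE // !det_mulmx mulrAC -det_mulmx dzVr //.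
  by rewrite det1 mul1r ev_det dW !hornerC.
(* The determinant of [G] is the constant [d], so its inverse is again polynomial. *)
have GadjG w : ev G w *m (d^-1 *: ev (\adj G) w) = 1%:M.
  by rewrite -scalemxAr ev_adj mul_mx_adj ev_det dG hornerC scale_scalar_mx mulVf.
exists (Ap *m W), ((d^-1)%:P *: (\adj G *m Am)); split.
- by move=> z z1; rewrite evM unitmx_mul uAp //= ev_unit dW hornerC.
- move=> z z1; rewrite ev_scale hornerC evM scalemxAl unitmx_mul uAm // andbT.
  by case: (mulmx1_unit (GadjG z)).
- have evB z : ev (Ap *m W) z = l *: ev Ap z + l^* *: qc (ev Ap z^*).
    by rewrite evM evW mulmxDr -!scalemxAr mulmx1 -evM -VE ev_qcp.
  apply: ev_eq_circle => z _; rewrite ev_qcp !evB qcD // !qcZ // qcK // !conjCK.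
  by rewrite addrC.
- move=> z z0; rewrite FA // ev_scale hornerC !evM scalemxAl !mulmxA.
  have dzK : dz (fun i => - - k i) z = dz k z by apply/matrixP => i j; rewrite !mxE opprK.
  have WD : ev W z *m dz k z = dz k z *m ev G z^-1.
    by rewrite GE ?invr_eq0 // !dz_inv invrK !mulmxA dzVr // mul1mx dzK.
  rewrite -(mulmxA _ (ev W z)) WD !mulmxA -[_ *m ev G _ *m _]mulmxA GadjG.
  by rewrite mulmx1.
Qed.

End QuaternionicFactorization.

(** * Consequences of skew symmetry for the factorization *)

Lemma invertible_on_disc_adjp (C : numClosedFieldType) n (M : 'M[{poly C}]_n) :
  invertible_on_disc M -> invertible_on_disc (adjp M).
Proof. by move=> uM z z1; rewrite ev_adjp adjm_unit uM // norm_le1_conj. Qed.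

(** Applying -dagger to the factorization gives a second one, with indices -k, plus factor
    -A_-^dagger and minus factor A_+^dagger. The two are compared in both directions. *)
Lemma skew_factor (C : numClosedFieldType) n (k : 'I_n -> int) (F : C -> 'M[C]_n)
    (Bp Bm : 'M[{poly C}]_n) :
  (forall i j : 'I_n, (i <= j)%N -> k j <= k i) ->
  invertible_on_disc Bp -> invertible_on_disc Bm ->
  (forall z : C, z != 0 -> F z = ev Bp z *m dz k z *m ev Bm z^-1) ->
  (forall z : C, z != 0 -> adjm (F (z^*)^-1) = - F z) ->
  (forall i, k (rev_ord i) = - k i) /\
  exists V : 'M[{poly C}]_n, [/\ \det V != 0,
    forall i j (m : nat), (V i j)`_m != 0 -> m%:Z <= k i + k j &
    forall z : C, `|z| = 1 ->
      F z = ev Bp z *m ev V z *m dz (fun i => - k i) z *m adjm (ev Bp z)].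
Proof.
move=> kd uBp uBm FB Fa; pose Cp := - adjp Bm; pose Cm := adjp Bp.
have uCp : invertible_on_disc Cp.
  by move=> z z1; rewrite evN -scaleN1r unitmxZ ?unitrN1 //; apply: invertible_on_disc_adjp.
have uCm : invertible_on_disc Cm by exact: invertible_on_disc_adjp.
have FC z : z != 0 -> F z = ev Cp z *m dz (fun i => - k i) z *m ev Cm z^-1.
  move=> z0; rewrite -[LHS]opprK -Fa // FB ?invr_eq0 ?conjC_eq0 // invrK.
  rewrite !adjmM adjm_dz fmorphV /= conjCK dz_inv /Cp /Cm evN !ev_adjp fmorphV.
  by rewrite mulmxA !mulNmx.
have [|V [VE degV]] := @wiener_hopf_quotient C n Bp Bm Cp Cm k (fun i => - k i) uBp uCm.
  by move=> z z0; rewrite -FB // -FC.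
have [|T [TE degT]] := @wiener_hopf_quotient C n Cp Cm Bp Bm (fun i => - k i) k uCp uBm.
  by move=> z z0; rewrite -FB // -FC.
have det0 (M : 'M[{poly C}]_n) : invertible_on_disc M -> \det M != 0.
  move=> /(_ 0); rewrite normr0 ler01 ev_unit => /(_ isT).
  by apply: contraNneq => ->; rewrite horner0.
have dV : \det V != 0.
  by have := det0 _ uCp; rewrite VE det_mulmx mulf_eq0 negb_or => /andP[].
have dT : \det T != 0.
  by have := det0 _ uBp; rewrite TE det_mulmx mulf_eq0 negb_or => /andP[].
have nzcoef (p : {poly C}) : p != 0 -> exists m, p`_m != 0.
  by move=> p0; exists (size p).-1; rewrite -lead_coefE lead_coef_eq0.
split; last first.
  exists V; split=> // [i j m /degV|z z1]; first by rewrite opprK.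
  have z0 : z != 0 by rewrite -normr_gt0 z1.
  by rewrite FC // /Cm ev_adjp VE evM fmorphV /= unit_circle_conj // invrK.
(* A nonzero entry has nonnegative degree, so k_i + k_s(i) >= 0 from [V] and k_i + k_t(i) <= 0 from
   [T]. *)
have [s sI sV] := det_neq0_inj dV; have [t tI tT] := det_neq0_inj dT.
apply: (nonincreasing_match_sym kd sI tI) => i.
  by have [m /degV] := nzcoef _ (sV i); lia.
by have [m /degT] := nzcoef _ (tT i); lia.
Qed.

(** * Square roots of unipotent self-dual matrices *)

Section SquareRoot.
Variables (C : numClosedFieldType) (n : nat) (S : 'M[C]_n) (k : 'I_n -> int).
Hypotheses (SS : S *m S = 1%:M).
Local Notation qc := (qc S).
Implicit Types x y g : 'M[{poly C}]_n.

(** Orders in this filtration add under products and are bounded on nonzero matrices, so a matrix of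
    order 1 is nilpotent. *)
Definition lower_by (m : nat) x := forall i j, x i j != 0 -> k j + m%:Z <= k i.

Lemma lower_byD m x y : lower_by m x -> lower_by m y -> lower_by m (x + y).
Proof.
move=> hx hy i j; rewrite mxE; have [x0|/hx//] := eqVneq (x i j) 0.
by rewrite x0 add0r => /hy.
Qed.
Lemma lower_byZ m c x : lower_by m x -> lower_by m (c *: x).
Proof.
by move=> hx i j; rewrite mxE => h; apply: hx; apply: contraNneq h => ->; rewrite mulr0.
Qed.
Lemma lower_byM l m x y : lower_by l x -> lower_by m y -> lower_by (l + m) (x *m y).
Proof.
move=> hx hy i j; rewrite mxE => /eqP sn0.
have [/existsP[r]|/existsPn h] := boolP [exists r, x i r * y r j != 0].
  by rewrite mulf_eq0 negb_or => /andP[/hx + /hy]; lia.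
by case: sn0; apply: big1 => r _; apply/eqP; rewrite -[_ == _]negbK.
Qed.
Lemma lower_by_le l m x : (l <= m)%N -> lower_by m x -> lower_by l x.
Proof. by move=> lm hx i j /hx; lia. Qed.

Lemma lower_by_large : exists m, forall x, lower_by m x -> x = 0.
Proof.
exists (\sum_i `|k i| + \sum_i `|k i|).+1%N => x hx; apply/matrixP => i j; rewrite mxE.
have le r : (`|k r| <= \sum_i `|k i|)%N by rewrite (bigD1 r) //= leq_addr.
by apply/eqP; apply: contraTT isT => /hx; have := le i; have := le j; lia.
Qed.

Variable H : C -> 'M[C]_n.

(* Self-adjoint quaternionic elements with respect to the involution
   [y |-> H y^dagger H^-1], a real Jordan algebra. *)
Definition selfdual y := forall z : C, `|z| = 1 ->
  ev y z *m H z = H z *m adjm (ev y z) /\ qc (ev y z^*) = ev y z.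

Lemma selfdual1 : selfdual 1%:M.
Proof. by move=> z z1; rewrite !ev1 adjm1 mulmx1 mul1mx qc1. Qed.
Lemma selfdualD x y : selfdual x -> selfdual y -> selfdual (x + y).
Proof.
move=> hx hy z z1; have [hx1 hx2] := hx z z1; have [hy1 hy2] := hy z z1.
by rewrite !evD adjmD mulmxDl mulmxDr hx1 hy1 qcD hx2 hy2.
Qed.
Lemma selfdualZ (c : C) x : c^* = c -> selfdual x -> selfdual (c%:P *: x).
Proof.
move=> cr hx z z1; have [hx1 hx2] := hx z z1.
by rewrite !ev_scale !hornerC adjmZ qcZ cr hx2 -scalemxAl -scalemxAr hx1.
Qed.
(** The involution reverses products, so only squares, not general products, stay self-dual;
    Newton's step needs no more. *)
Lemma selfdual_sqr x : selfdual x -> selfdual (x *m x).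
Proof.
move=> hx z z1; have [hx1 hx2] := hx z z1.
by rewrite !evM adjmM qcM // hx2 -mulmxA hx1 mulmxA hx1 mulmxA.
Qed.

(* Newton's iteration [g |-> g - (g^2 - 1 - x) / 2] from 1: each step raises the order
   to which [g^2 = 1 + x] holds, even though [g] and [x] need not commute. *)
Lemma selfdual_sqrt x : selfdual x -> lower_by 1 x ->
  exists g, selfdual g /\ g *m g = 1%:M + x.
Proof.
move=> xs xl.
have step m : exists g, [/\ selfdual g, lower_by 1 (g - 1%:M) &
    lower_by m.+1 (g *m g - (1%:M + x))].
  elim: m => [|m [g [gs gl]]].
    exists 1%:M; split; first exact: selfdual1.
      by move=> i j; rewrite subrr mxE eqxx.
    by rewrite mulmx1 opprD addNKr -scaleN1r; apply: lower_byZ.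
  set e := g *m g - _ => el.
  have cr : (- 2^-1 : C)^* = - 2^-1 by rewrite rmorphN fmorphV rmorph_nat.
  have es : selfdual e.
    apply: selfdualD; first exact: selfdual_sqr.
    rewrite -scaleN1r (_ : -1 = (-1)%:P); last by rewrite polyCN.
    by apply: selfdualZ; [rewrite rmorphN1 | apply: selfdualD => //; exact: selfdual1].
  have gg : g *m g = e + (1%:M + x) by rewrite subrK.
  clearbody e; pose c : {poly C} := (- 2^-1)%:P.
  have c2 : c + c = -1.
    by rewrite -polyCD -opprD -mulr2n -[_ *+ 2]mulr_natl mulfV ?pnatr_eq0 // polyCN.
  exists (g + c *: e); split.
  - by apply: selfdualD => //; exact: selfdualZ.
  - rewrite addrAC; apply: lower_byD => //; apply: lower_byZ.
    by apply: lower_by_le el.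
  (* With 2c = -1 the error [e] cancels to first order; what remains has order at least m + 2, since
     g - 1 has order 1 and e has order m + 1. *)
  - have -> : (g + c *: e) *m (g + c *: e) - (1%:M + x)
        = c *: ((g - 1%:M) *m e + e *m (g - 1%:M)) + (c * c) *: (e *m e).
      rewrite (mulmxBl g) (mulmxBr e) mul1mx mulmx1.
      rewrite mulmxDl !mulmxDr -!scalemxAl -!scalemxAr scalerA gg.
      rewrite (addrACA (g *m e)) -opprD scalerBr [c *: (e + e)]scalerDr -scalerDl c2.
      rewrite scaleN1r opprK scalerDr; apply/eqP; rewrite subr_eq; apply/eqP.
      move: (1%:M + x) (g *m e) (e *m g) (e *m e) => w p q r.
      rewrite (addrC e) -!addrA addrC -!addrA addrCA; congr (_ + _).
      by rewrite addrCA.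
    apply: lower_byD; apply: lower_byZ.
      apply: lower_byD; first exact: (lower_byM gl el).
      by rewrite -addn1; exact: (lower_byM el gl).
    by apply: lower_by_le (lower_byM el el); lia.
have [m m0] := lower_by_large; have [g [gs _ gl]] := step m.
exists g; split=> //; apply/eqP; rewrite -subr_eq0; apply/eqP/m0.
by apply: lower_by_le gl.
Qed.

End SquareRoot.

(** * Reduction of the middle factor to a constant normal form *)

Section Core.
Variables (C : numClosedFieldType) (n : nat) (S : 'M[C]_n) (k : 'I_n -> int).
Hypotheses (SS : S *m S = 1%:M) (Sc : mconj S = - S) (Sa : adjm S = S).
Hypothesis Sk : homogeneous k S.
Local Notation qc := (qc S).
Local Notation D z := (dz (fun i => - k i) z).

(** The target [j] is arbitrary among the normalized skew quaternionic matrices reversing the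
    grading, so that the caller can choose it to match D_4. *)
Lemma skew_normal_form (F : C -> 'M[C]_n) (Bp V : 'M[{poly C}]_n) (j : 'M[C]_n) :
  invertible_on_disc Bp -> qcp S Bp = Bp ->
  (forall z, `|z| = 1 -> F z = ev Bp z *m ev V z *m D z *m adjm (ev Bp z)) ->
  (forall z, `|z| = 1 -> adjm (F z) = - F z) ->
  (forall z, `|z| = 1 -> qc (F z^*) = F z) ->
  \det V != 0 -> \sum_i k i = 0 ->
  (forall i j (m : nat), (V i j)`_m != 0 -> m%:Z <= k i + k j) ->
  adjm j = - j -> qc j = j -> antihomogeneous k j -> j *m j = - 1%:M ->
  exists B, [/\ invertible_on_disc B, qcp S B = B &
    forall z, `|z| = 1 -> F z = ev B z *m j *m D z *m adjm (ev B z)].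
Proof.
move=> uB qB FV Fa Fq dV k0 degV ja jq jk jj.
pose H z := ev V z *m D z.
have uBz z : `|z| = 1 -> ev Bp z \in unitmx by move=> z1; rewrite uB ?z1.
have uDz z : z != 0 -> D z \in unitmx by move=> z0; case: (mulmx1_unit (dzVl k z0)).
have z0 (z : C) : `|z| = 1 -> z != 0 by move=> z1; rewrite -normr_gt0 z1.
have FH z : `|z| = 1 -> F z = ev Bp z *m H z *m adjm (ev Bp z).
  by move=> z1; rewrite FV // /H mulmxA.
have qBz z : qc (ev Bp z^*) = ev Bp z by rewrite -ev_qcp qB.
have cancel z X Y : `|z| = 1 ->
    ev Bp z *m X *m adjm (ev Bp z) = ev Bp z *m Y *m adjm (ev Bp z) -> X = Y.
  move=> z1 E; have := congr1 (fun Z => invmx (ev Bp z) *m Z *m invmx (adjm (ev Bp z))) E.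
  by rewrite /= !mulmxA !mulmxK ?adjm_unit ?uBz // !mulVmx ?uBz // !mul1mx.
have Ha z : `|z| = 1 -> adjm (H z) = - H z.
  move=> z1; apply: (cancel z) => //; have := Fa z z1; rewrite FH // !adjmM adjmK.
  by rewrite mulmxN mulNmx mulmxA.
have Hq z : `|z| = 1 -> qc (H z^*) = H z.
  move=> z1; apply: (cancel z) => //; have := Fq z z1; rewrite !FH ?norm_conjC //.
  by rewrite !qcM // qc_adjm // !qBz.
have Vq z : `|z| = 1 -> qc (ev V z^*) = ev V z.
  move=> z1; have := Hq z z1; rewrite /H qcM // qc_dzN //.
  by move/(congr1 (mulmx^~ (invmx (D z)))); rewrite /= !mulmxK // uDz // z0.
pose h : 'M[C]_n := \matrix_(i, i') if k i + k i' == 0 then (V i i')`_0 else 0.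
have dVh : \det V = (\det h)%:P by apply: det_degree_bound; rewrite // k0 addr0.
have hu : h \in unitmx.
  by rewrite unitmxE unitfE; apply: contraNneq dV; rewrite dVh => ->.
have VC i i' : k i + k i' = 0 -> V i i' = ((V i i')`_0)%:P.
  move=> kk; apply/polyP => -[|m]; rewrite coefC //=.
  by apply/eqP; apply: contraTT isT => /degV; rewrite kk.
have hE i i' z : h i i' = if k i + k i' == 0 then ev V z i i' else 0.
  by rewrite mxE evE; case: eqP => // /VC ->; rewrite hornerC coefC.
have norm1c : `|1 : C| = 1 by rewrite normr1.
have hk : antihomogeneous k h.
  by move=> i i'; rewrite mxE; case: ifP => [/eqP kk _|_]; [lia | rewrite eqxx].
(* At z = 1 the diagonal factor disappears, so the skewness of [H] passes to V(1) and to its entries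
   kept in [h]. *)
have D1 : D (1 : C) = 1%:M by apply/matrixP => i i'; rewrite !mxE exp1rz.
have ha : adjm h = - h.
  apply/matrixP => i i'; rewrite adjmE [RHS]mxE !(hE _ _ 1) addrC.
  case: ifP; rewrite ?rmorph0 ?oppr0 // => _.
  by have /matrixP/(_ i i') := Ha 1 norm1c; rewrite /H D1 mulmx1 adjmE [RHS]mxE.
have hq : qc h = h.
  apply/qc_fix_comm => //.
  have /qc_fix_comm/matrixP E : qc (ev V 1) = ev V 1 by rewrite -{1}(conjC1 C) Vq.
  apply/matrixP => i i'; have := E SS i i'; rewrite !mxE => {}E.
  (* [S] preserves degrees, so the condition selecting the entries of [h] moves through products
     with [S] on either side. *)
  transitivity (if k i + k i' == 0 then \sum_r ev V 1 i r * S r i' else 0).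
    rewrite -[RHS](_ : \sum_r (if k i + k i' == 0 then ev V 1 i r * S r i' else 0) = _).
      apply: eq_bigr => r _; rewrite (hE _ _ 1).
      have [->|/Sk ->] := eqVneq (S r i') 0; first by rewrite !mulr0; case: ifP.
      by case: ifP; rewrite ?mul0r.
    by case: ifP => // _; rewrite big1.
  rewrite E -[LHS](_ : \sum_r (if k i + k i' == 0 then S i r * (mconj (ev V 1)) r i' else 0) = _).
    apply: eq_bigr => r _; rewrite !mconjE (hE _ _ 1).
    have [->|/Sk ->] := eqVneq (S i r) 0; first by rewrite !mul0r; case: ifP.
    by case: ifP; rewrite ?rmorph0 ?mulr0.
  by case: ifP => // _; rewrite big1.
pose H0 z := h *m D z.
have adjD z : `|z| = 1 -> adjm (D z) = dz k z.
  move=> z1; rewrite adjm_dz unit_circle_conj // dz_inv.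
  by apply/matrixP => i i'; rewrite !mxE opprK.
have hD z : h *m D z = dz k z *m h.
  rewrite -[D z]/(dg k (fun x => z ^ - x)) antihomogeneous_dg //; congr (_ *m _).
  by apply/matrixP => i i'; rewrite !mxE /= opprK.
have H0a z : `|z| = 1 -> adjm (H0 z) = - H0 z.
  by move=> z1; rewrite /H0 adjmM adjD // ha mulmxN hD.
pose hi := invmx h.
have hiq : qc hi = hi by rewrite /hi qc_inv // hq.
have hik : antihomogeneous k hi.
  pose g := dg k (intr : int -> C).
  apply: antihomogeneousP; rewrite -/g /hi -[LHS](mulKmx hu).
  rewrite [h *m (g *m _)]mulmxA (antihomogeneous_dgN hk) -/g mulNmx -mulmxA mulmxV //.
  by rewrite mulmx1 mulmxN.
pose x : 'M[{poly C}]_n := (V - map_mx polyC h) *m map_mx polyC hi.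
have x1 z : 1%:M + ev x z = ev V z *m hi.
  by rewrite /x evM evD evN !evC mulmxDl mulNmx mulmxV // addrC subrK.
have xH0 z : ev x z *m H0 z = H z - H0 z.
  apply: (addrI (H0 z)); rewrite -{1}[H0 z]mul1mx -mulmxDl x1 [RHS]addrC subrK.
  by rewrite /H0 mulmxA mulmxKV.
have xs : selfdual S H0 x.
  move=> z z1; split; last first.
    apply: (addrI 1%:M); rewrite x1 -[in LHS](qc1 SS) -qcD x1 qcM // Vq // hiq //.
  have := congr1 (@adjm C n) (xH0 z); rewrite adjmM adjmD adjmN Ha // !H0a //.
  by rewrite mulNmx -opprD => /oppr_inj ->.
(* The entries of V - h survive only where k_i + k_r > 0, and h^-1 has entries only where k_r =
   -k_i', so k_i > k_i'. *)
have xl : lower_by k 1 x.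
  move=> i i'; rewrite mxE => /eqP sn0.
  have [/existsP[r]|/existsPn hh] := boolP [exists r,
    (V - map_mx polyC h) i r * (map_mx polyC hi) r i' != 0]; last first.
    by case: sn0; apply: big1 => r _; apply/eqP; rewrite -[_ == _]negbK.
  rewrite mulf_eq0 negb_or => /andP[+ +].
  rewrite [map_mx _ _ r i']mxE polyC_eq0 => + /hik kr.
  rewrite !mxE.
  case: (ltrgtP (k i + k r) 0) => kir; last by rewrite {1}(VC _ _ kir) subrr eqxx.
    rewrite polyC0 subr0 => V0; have [m] : exists m, (V i r)`_m != 0.
      by exists (size (V i r)).-1; rewrite -lead_coefE lead_coef_eq0.
    by move/degV; lia.
  by move=> _; lia.
have [g [gs gg]] := selfdual_sqrt SS xs xl.
have [w [wj wq wk wu]] := skew_qc_congruent SS Sc Sa Sk ha hq hk hu ja jq jk jj.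
have gu z : ev g z \in unitmx.
  have : ev g z *m ev g z \in unitmx.
    rewrite -evM gg evD ev1 x1 unitmx_mul unitmx_inv hu andbT ev_unit dVh hornerC.
    by rewrite -unitfE -unitmxE.
  by rewrite unitmx_mul => /andP[].
exists (Bp *m g *m map_mx polyC w); split.
- by move=> z z1; rewrite !evM evC !unitmx_mul uB // gu wu.
- apply: ev_eq_circle => z z1; rewrite ev_qcp // !evM !evC !qcM // qBz.
  by have [_ ->] := gs z z1; rewrite wq.
- move=> z z1; have [gH _] := gs z z1.
  have wD : adjm w *m D z = D z *m adjm w.
    rewrite -[D z]/(dg k (fun y => z ^ - y)) homogeneous_dg //.
    exact: homogeneous_adjm.
  (* Self-duality splits the square: g^2 H0 = g H0 g^dagger. *)
  have HE : H z = ev g z *m (w *m j *m D z *m adjm w) *m adjm (ev g z).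
    rewrite -[w *m j *m _ *m _]mulmxA -wD (mulmxA (w *m j)) wj -/(H0 z) -mulmxA -gH mulmxA.
    by rewrite -evM gg evD ev1 mulmxDl mul1mx xH0 addrC subrK.
  by rewrite FH // HE !evM evC !adjmM !mulmxA.
Qed.

End Core.

(** * Laurent matrix functions and coefficient lists *)

Section LaurentMatrices.
Variables (C : numClosedFieldType) (n : nat).
Implicit Types (F G : C -> 'M[C]_n) (z : C).

(** For such functions an equality on the unit circle, where dagger is the pointwise adjoint,
    extends to all nonzero z. *)
Definition laurent F := exists (P : 'M[{poly C}]_n) (N : nat),
  forall z, z != 0 -> z ^+ N *: F z = ev P z.

Lemma laurent_eq F G : laurent F -> laurent G ->
  (forall z, `|z| = 1 -> F z = G z) -> forall z, z != 0 -> F z = G z.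
Proof.
move=> [P [N FP]] [Q [M GQ]] FG z z0.
have PQ : 'X^M *: P = 'X^N *: Q.
  apply: ev_eq_circle => w w1; have w0 : w != 0 by rewrite -normr_gt0 w1.
  by rewrite !ev_scale !hornerXn -FP // -GQ // FG // !scalerA mulrC.
have NM0 : z ^+ M * z ^+ N != 0 by rewrite mulf_neq0 ?expf_neq0.
apply: (scalerI NM0); rewrite -scalerA FP // mulrC -scalerA GQ //.
by have := congr1 (fun X => ev X z) PQ; rewrite !ev_scale !hornerXn.
Qed.

Lemma laurentM F G : laurent F -> laurent G -> laurent (fun z => F z *m G z).
Proof.
move=> [P [N FP]] [Q [M GQ]]; exists (P *m Q), (N + M)%N => z z0.
by rewrite evM -FP // -GQ // -scalemxAl -scalemxAr scalerA exprD.
Qed.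

Lemma laurentD F G : laurent F -> laurent G -> laurent (fun z => F z + G z).
Proof.
move=> [P [N FP]] [Q [M GQ]]; exists ('X^M *: P + 'X^N *: Q), (N + M)%N => z z0.
by rewrite evD !ev_scale !hornerXn -FP // -GQ // !scalerA scalerDr exprD (mulrC (z ^+ M)).
Qed.

Lemma laurent_ev (P : 'M[{poly C}]_n) : laurent (ev P).
Proof. by exists P, 0%N => z z0; rewrite expr0 scale1r. Qed.

Lemma laurent_ext F G : (forall z, z != 0 -> F z = G z) -> laurent F -> laurent G.
Proof. by move=> FG [P [N FP]]; exists P, N => z z0; rewrite -FG // FP. Qed.

Lemma laurent_monomial (m : int) (A : 'M[C]_n) : laurent (fun z => z ^ m *: A).
Proof.
case: m => m; [exists ('X^m *: map_mx polyC A), 0%N|exists (map_mx polyC A), m.+1] => z z0.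
  by rewrite expr0 scale1r ev_scale hornerXn evC.
by rewrite evC scalerA NegzE /= mulfV ?scale1r // expf_neq0.
Qed.

Lemma laurent_sum (I : Type) (r : seq I) (F : I -> C -> 'M[C]_n) :
  (forall i, laurent (F i)) -> laurent (fun z => \sum_(i <- r) F i z).
Proof.
move=> lF; elim: r => [|i r IH].
  by exists 0, 0%N => z z0; rewrite big_nil scaler0; apply/matrixP => i j; rewrite evE !mxE horner0.
by apply: laurent_ext (laurentD (lF i) IH) => z _; rewrite big_cons.
Qed.

Lemma laurent_leval (p : lpoly C n) : laurent (leval p).
Proof. by apply: laurent_sum => i; exact: laurent_monomial. Qed.

Lemma laurent_dz (k : 'I_n -> int) : laurent (dz k).
Proof.
apply: laurent_ext (laurent_sum (index_enum 'I_n) (fun i => laurent_monomial (k i) (delta_mx i i))).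
move=> z z0; apply/matrixP => i j; rewrite summxE (bigD1 i) //= big1 => [|r ri].
  by rewrite !mxE eqxx eq_sym addr0 mulr_natr.
by rewrite !mxE [i == r]eq_sym (negPf ri) mulr0.
Qed.

Definition matrix_poly_of_seq (s : seq 'M[C]_n) : 'M[{poly C}]_n :=
  \matrix_(i, j) \poly_(m < size s) s`_m i j.

Lemma ev_matrix_poly_of_seq s z : ev (matrix_poly_of_seq s) z = peval s z.
Proof.
apply/matrixP => i j; rewrite evE mxE horner_poly summxE.
by apply: eq_bigr => m _; rewrite mxE mulrC.
Qed.

Definition coefmx (m : nat) (P : 'M[{poly C}]_n) : 'M[C]_n := map_mx (fun p : {poly C} => p`_m) P.
Definition degmx (P : 'M[{poly C}]_n) : nat := \max_ij size (P ij.1 ij.2).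
Definition seq_of_matrix_poly (P : 'M[{poly C}]_n) := mkseq (coefmx^~ P) (degmx P).

Lemma size_degmx (P : 'M[{poly C}]_n) i j : (size (P i j) <= degmx P)%N.
Proof. exact: (@leq_bigmax _ (fun ij => size (P ij.1 ij.2)) (i, j)). Qed.

Lemma peval_seq_of_matrix_poly (P : 'M[{poly C}]_n) z : peval (seq_of_matrix_poly P) z = ev P z.
Proof.
apply/matrixP => i j; rewrite evE (horner_coef_wide _ (size_degmx P i j)) summxE.
rewrite size_mkseq; apply: eq_bigr => m _.
by rewrite nth_mkseq // !mxE mulrC.
Qed.

Lemma coefmx_mulCl m (A : 'M[C]_n) (P : 'M[{poly C}]_n) :
  coefmx m (map_mx polyC A *m P) = A *m coefmx m P.
Proof.
apply/matrixP => i j; rewrite !mxE coef_sum; apply: eq_bigr => r _.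
by rewrite !mxE coefCM.
Qed.
Lemma coefmx_mulCr m (A : 'M[C]_n) (P : 'M[{poly C}]_n) :
  coefmx m (P *m map_mx polyC A) = coefmx m P *m A.
Proof.
apply/matrixP => i j; rewrite !mxE coef_sum; apply: eq_bigr => r _.
by rewrite !mxE coefMC.
Qed.
Lemma coefmx_conjp m (P : 'M[{poly C}]_n) : coefmx m (conjp P) = mconj (coefmx m P).
Proof. by apply/matrixP => i j; rewrite !mxE coef_map. Qed.

Lemma leval_ldagger (p : lpoly C n) z : z != 0 ->
  leval (ldagger p) z = adjm (leval p (z^*)^-1).
Proof.
move=> z0; case: p => low s; rewrite /leval /ldagger /=.
rewrite size_rev size_map (reindex_inj rev_ord_inj) /= /adjm /mconj.
rewrite raddf_sum raddf_sum /=; apply: eq_bigr => i _.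
have lti := ltn_ord i; rewrite nth_rev ?size_map; last by lia.
rewrite (_ : (size s - (size s - i.+1).+1 = i)%N); last by lia.
rewrite (nth_map 0) // map_mxZ linearZ /= -/(mconj _) -/(adjm _); congr (_ *: _).
rewrite fmorphXz fmorphV /= conjCK exprz_inv; congr (_ ^ _).
have := ltn_ord i; lia.
Qed.

Lemma peval_leval (s : seq 'M[C]_n) z : leval (poly_lpoly s) z = peval s z.
Proof. by apply: eq_bigr => i _; rewrite add0r. Qed.

End LaurentMatrices.

(** * Generalized permutation matrices *)

Section Monomial.
Variables (C : numClosedFieldType) (n : nat).
Implicit Types (r : 'I_n -> 'I_n) (u : 'I_n -> C).

(** [Sy], D_4(1), [dz] and the block reversal all have this form, so matrix identities reduce to
    checks on [r] and [u]. *)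
Definition mono r u : 'M[C]_n := \matrix_(i, j) if j == r i then u i else 0.

Lemma mono_mulE r u (M : 'M[C]_n) i j : (mono r u *m M) i j = u i * M (r i) j.
Proof.
rewrite mxE (bigD1 (r i)) //= big1 => [|l lr]; first by rewrite mxE eqxx addr0.
by rewrite mxE (negPf lr) mul0r.
Qed.

Lemma mul_monoE r u (M : 'M[C]_n) i j : involutive r ->
  (M *m mono r u) i j = M i (r j) * u (r j).
Proof.
move=> rK; rewrite mxE (bigD1 (r j)) //= big1 => [|l lr].
  by rewrite mxE rK eqxx addr0.
rewrite mxE; have [jl|_] := eqVneq j (r l); last by rewrite mulr0.
by rewrite jl rK eqxx in lr.
Qed.

Lemma eq_mono r r' u u' : r =1 r' -> u =1 u' -> mono r u = mono r' u'.
Proof. by move=> rr uu; apply/matrixP => i j; rewrite !mxE rr uu. Qed.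

Lemma monoM r r' u u' : mono r u *m mono r' u' = mono (r' \o r) (fun i => u i * u' (r i)).
Proof.
apply/matrixP => i j; rewrite mono_mulE !mxE /=.
by case: ifP; rewrite ?mulr0.
Qed.

Lemma mono1 : mono id (fun=> 1) = 1%:M.
Proof. by apply/matrixP => i j; rewrite !mxE eq_sym; case: eqP. Qed.

Lemma monoN r u : - mono r u = mono r (fun i => - u i).
Proof. by apply/matrixP => i j; rewrite !mxE; case: ifP; rewrite ?oppr0. Qed.

Lemma mconj_mono r u : mconj (mono r u) = mono r (fun i => (u i)^*).
Proof. by apply/matrixP => i j; rewrite !mxE; case: ifP; rewrite ?rmorph0. Qed.

Lemma adjm_mono r u : involutive r -> adjm (mono r u) = mono r (fun i => (u (r i))^*).
Proof.
move=> rK; apply/matrixP => i j; rewrite adjmE !mxE.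
have -> : (i == r j) = (j == r i) by apply/eqP/eqP => ->; rewrite rK.
by case: eqP => [->//|]; rewrite rmorph0.
Qed.

Lemma dz_mono (k : 'I_n -> int) z : dz k z = mono id (fun i => z ^ k i).
Proof.
by apply/matrixP => i j; rewrite !mxE eq_sym; case: eqP.
Qed.

End Monomial.

(** * Index arithmetic for 2x2 blocks *)

Section BlockIndices.
Variable d : nat.
Implicit Types (m : 'I_d) (b : 'I_2) (i j : 'I_(2 * d)).

Lemma pair_ord_proof m b : (m * 2 + b < 2 * d)%N.
Proof. by have := ltn_ord m; have := ltn_ord b; lia. Qed.
Definition pair_ord m b : 'I_(2 * d) := Ordinal (pair_ord_proof m b).

Lemma half_pair m b : half_ord (pair_ord m b) = m.
Proof. by apply: val_inj => /=; rewrite divnMDl // divn_small ?addn0 // ltn_ord. Qed.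
Lemma par_pair m b : par_ord (pair_ord m b) = b.
Proof. by apply: val_inj => /=; rewrite modnMDl modn_small // ltn_ord. Qed.
Lemma eq_pair_ord i m b : (i == pair_ord m b) = (half_ord i == m) && (par_ord i == b).
Proof.
apply/eqP/andP => [->|[/eqP <- /eqP <-]]; first by rewrite half_pair par_pair.
by apply: val_inj => /=; rewrite -divn_eq.
Qed.

Definition flip_par i := pair_ord (half_ord i) (rev_ord (par_ord i)).
Definition rev_block i := pair_ord (rev_ord (half_ord i)) (par_ord i).

Lemma pair_half_par i : pair_ord (half_ord i) (par_ord i) = i.
Proof. by apply/esym/eqP; rewrite eq_pair_ord !eqxx. Qed.
Lemma half_flip i : half_ord (flip_par i) = half_ord i. Proof. exact: half_pair. Qed.
Lemma par_flip i : par_ord (flip_par i) = rev_ord (par_ord i). Proof. exact: par_pair. Qed.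
Lemma half_rev i : half_ord (rev_block i) = rev_ord (half_ord i). Proof. exact: half_pair. Qed.
Lemma par_rev i : par_ord (rev_block i) = par_ord i. Proof. exact: par_pair. Qed.
Lemma flip_parK : involutive flip_par.
Proof. by move=> i; rewrite {1}/flip_par half_flip par_flip rev_ordK pair_half_par. Qed.
Lemma rev_blockK : involutive rev_block.
Proof. by move=> i; rewrite {1}/rev_block half_rev par_rev rev_ordK pair_half_par. Qed.
Lemma flip_rev i : flip_par (rev_block i) = rev_block (flip_par i).
Proof. by rewrite /flip_par /rev_block !half_pair !par_pair. Qed.

(** This turns the symmetry of the 2d doubled indices into that of [kap]. *)
Lemma half_rev_ord i : half_ord (rev_ord i) = rev_ord (half_ord i).
Proof.
apply: val_inj => /=; have := ltn_ord i; have := divn_eq i 2.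
have := ltn_pmod i (isT : 0 < 2)%N; lia.
Qed.
End BlockIndices.

Lemma ord2_rev0 (b : 'I_2) : (rev_ord b == 0) = (b != 0).
Proof. by case: b => -[|[|b]] hb. Qed.

(** * The matrices sigma_y, D_4 and the block reversal *)

Section Concrete.
Variables (C : numClosedFieldType) (d : nat).
Implicit Types (i j : 'I_(2 * d)).

Lemma SyE : Sy C d = mono (@flip_par d) (fun i => if par_ord i == 0 then - 'i else 'i).
Proof.
apply/matrixP => i j; rewrite summxE (bigD1 (half_ord i)) //= big1 => [|m mi].
  rewrite addr0 !mxE eqxx /= eq_pair_ord.
  case: (half_ord j == _) => //=.
  by case: (par_ord i) => -[|[|a]] ha //; case: (par_ord j) => -[|[|b]] hb.
by rewrite mxE eq_sym (negPf mi).
Qed.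

Lemma Sy_sqr : Sy C d *m Sy C d = 1%:M.
Proof.
rewrite SyE monoM -mono1; apply: eq_mono => i /=; first exact: flip_parK.
rewrite par_flip ord2_rev0; case: eqP => _ /=; last by rewrite mulrN -expr2 sqrCi opprK.
by rewrite mulNr -expr2 sqrCi opprK.
Qed.

Lemma mconj_Sy : mconj (Sy C d) = - Sy C d.
Proof.
rewrite SyE mconj_mono monoN; apply: eq_mono => // i.
by case: ifP => _; rewrite ?rmorphN /= conjCi.
Qed.

Lemma adjm_Sy : adjm (Sy C d) = Sy C d.
Proof.
rewrite SyE adjm_mono; last exact: flip_parK.
apply: eq_mono => // i; rewrite par_flip ord2_rev0.
by case: eqP => _ /=; rewrite ?rmorphN /= conjCi ?opprK.
Qed.

Variable kap : 'I_d -> int.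
Local Notation k := (fun i : 'I_(2 * d) => kap (half_ord i)).

Lemma homogeneous_Sy : homogeneous k (Sy C d).
Proof.
move=> i j; rewrite SyE mxE; case: ifP => [/eqP -> _|_]; last by rewrite eqxx.
by rewrite half_flip.
Qed.

Hypothesis kap_rev : forall m, kap (rev_ord m) = - kap m.

Definition D4_perm i := if kap (half_ord i) == 0 then i else rev_block i.
Definition D4_sign i : C := if kap (half_ord i) == 0 then (if par_ord i == 0 then 'i else - 'i)
  else if 0 < kap (half_ord i) then 1 else -1.

Lemma kap_D4_perm i : kap (half_ord (D4_perm i)) = - kap (half_ord i).
Proof.
rewrite /D4_perm; case: eqP => [->|_]; first by rewrite oppr0.
by rewrite half_rev kap_rev.
Qed.

Lemma D4_permK : involutive D4_perm.
Proof.
move=> i; rewrite /D4_perm; case E: (kap (half_ord i) == 0); rewrite ?E //.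
by rewrite half_rev kap_rev oppr_eq0 E rev_blockK.
Qed.

Lemma D4_sign_sqr i : D4_sign i * D4_sign (D4_perm i) = -1.
Proof.
rewrite /D4_sign kap_D4_perm oppr_eq0 oppr_gt0 /D4_perm.
case: (ltrgtP (kap (half_ord i)) 0) => h; rewrite ?mul1r ?mulr1 //.
by case: eqP => _; rewrite ?mulrNN -expr2 sqrCi.
Qed.

Lemma D4_sign_conj i : (D4_sign (D4_perm i))^* = - D4_sign i.
Proof.
rewrite /D4_sign kap_D4_perm oppr_eq0 oppr_gt0 /D4_perm.
case: (ltrgtP (kap (half_ord i)) 0) => h; rewrite ?rmorph1 ?rmorphN1 ?opprK //.
by case: eqP => _; rewrite ?rmorphN /= conjCi.
Qed.

(** This is D_4 at z = 1. *)
Definition D4_one : 'M[C]_(2 * d) := mono D4_perm D4_sign.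

Lemma sum_blkl (p : pred 'I_d) (f : 'I_d -> 'I_d) (c : 'I_d -> C) (B : 'M[C]_2) i j :
  (\sum_(m | p m) c m *: blk (f m) m B) i j =
  if p (half_ord j) && (half_ord i == f (half_ord j))
  then c (half_ord j) * B (par_ord i) (par_ord j) else 0.
Proof.
rewrite summxE big_mkcond (bigD1 (half_ord j)) //= big1 => [|m mj].
  by rewrite addr0 !mxE eqxx andbT; case: (p _) => //=; case: ifP; rewrite ?mulr0.
by rewrite !mxE [half_ord j == m]eq_sym (negPf mj) andbF mulr0 if_same.
Qed.

Lemma sum_blkr (p : pred 'I_d) (f : 'I_d -> 'I_d) (c : 'I_d -> C) (B : 'M[C]_2) i j :
  (\sum_(m | p m) c m *: blk m (f m) B) i j =
  if p (half_ord i) && (half_ord j == f (half_ord i))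
  then c (half_ord i) * B (par_ord i) (par_ord j) else 0.
Proof.
rewrite summxE big_mkcond (bigD1 (half_ord i)) //= big1 => [|m mj].
  by rewrite addr0 !mxE eqxx; case: (p _) => //=; case: ifP; rewrite ?mulr0.
by rewrite !mxE [half_ord i == m]eq_sym (negPf mj) mulr0 if_same.
Qed.

(** By the symmetry of [kap], the coefficient z^(-kap m) in block column [rev_ord m] is z^(kap
    (rev_ord m)), so all powers of z sit in the right factor. *)
Lemma D4E z : D4 kap z = D4_one *m dz k z.
Proof.
apply/matrixP => i j; rewrite mul_mx_dz /D4 sumrB !mxE sum_blkl sum_blkr.
have -> : (\sum_(m < d | kap m == 0) blk m m (qk C)) i j =
    (\sum_(m < d | kap m == 0) (1 : C) *: blk m (id m) (qk C)) i j.
  by congr (fun_of_matrix _ i j); apply: eq_bigr => m _; rewrite scale1r.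
rewrite (sum_blkr _ id) !mxE /D4_perm /D4_sign.
have jr : (j == rev_block i) = (half_ord j == rev_ord (half_ord i)) && (par_ord j == par_ord i).
  exact: eq_pair_ord.
have -> : (half_ord i == rev_ord (half_ord j)) = (half_ord j == rev_ord (half_ord i)).
  by apply/eqP/eqP => ->; rewrite rev_ordK.
have ji : (j == i) = (half_ord j == half_ord i) && (par_ord j == par_ord i).
  by rewrite -{1}(pair_half_par i) eq_pair_ord.
have kj : half_ord j = rev_ord (half_ord i) -> kap (half_ord j) = - kap (half_ord i).
  by move=> ->.
rewrite [par_ord j == _]eq_sym in jr ji.
case: (ltrgtP (kap (half_ord i)) 0) => hi; rewrite /= ?jr ?ji ?addr0 ?subr0 ?sub0r.
- have [/kj kjE|_] := eqVneq (half_ord j) (rev_ord (half_ord i)).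
    rewrite kjE oppr_gt0 hi /=; case: eqP => _; rewrite ?mulr0 ?oppr0 ?mul0r //.
    by rewrite mulr1 mulN1r.
  by rewrite andbF oppr0 mul0r.
- have [/kj kjE|_] := eqVneq (half_ord j) (rev_ord (half_ord i)).
    rewrite kjE oppr_gt0 ltNge ltW //= opprB subr0.
    by case: eqP => _; rewrite ?mulr0 ?mul0r // mulr1 mul1r.
  by rewrite andbF subrr oppr0 mul0r.
- have -> : (0 < kap (half_ord j)) && (half_ord j == rev_ord (half_ord i)) = false.
    have [/kj ->|_] := eqVneq (half_ord j) (rev_ord (half_ord i)); rewrite ?andbF //.
    by rewrite hi oppr0 ltxx.
  rewrite oppr0 add0r mul1r; case: eqP => [->|_]; last by rewrite mul0r.
  rewrite hi expr0z mulr1 /=; case: eqP => _; last by rewrite mulr0.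
  by case: eqP; rewrite ?mulr1 ?mulrN1.
Qed.


Lemma qc_D4_one : qc (Sy C d) D4_one = D4_one.
Proof.
apply/(qc_fix_comm Sy_sqr); rewrite SyE mconj_mono !monoM; apply: eq_mono => i /=.
  by rewrite /D4_perm half_flip; case: ifP => _ //; rewrite flip_rev.
rewrite /D4_perm /D4_sign half_flip; case: ifP => _.
  by rewrite par_flip ord2_rev0; case: eqP => _ /=; rewrite ?rmorphN /= conjCi ?opprK mulrC.
by rewrite par_rev; case: ifP => _; rewrite ?rmorph1 ?rmorphN1 mulrC.
Qed.

Lemma adjm_D4_one : adjm D4_one = - D4_one.
Proof.
rewrite adjm_mono; last exact: D4_permK.
by rewrite monoN; apply: eq_mono => // i; exact: D4_sign_conj.
Qed.

Lemma D4_one_sqr : D4_one *m D4_one = - 1%:M.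
Proof.
rewrite monoM -mono1 monoN; apply: eq_mono => i; first exact: D4_permK.
exact: D4_sign_sqr.
Qed.

Lemma antihomogeneous_D4_one : antihomogeneous k D4_one.
Proof.
move=> i j; rewrite mxE; case: ifP => [/eqP -> _|_]; last by rewrite eqxx.
by rewrite kap_D4_perm opprK.
Qed.

(** D_4 ends in [dz k], whereas [skew_normal_form] ends in [dz] of -k; conjugation by the block
    reversal exchanges the two. *)
Definition revP : 'M[C]_(2 * d) := mono (@rev_block d) (fun=> 1).

Lemma revP_sqr : revP *m revP = 1%:M.
Proof.
by rewrite monoM -mono1; apply: eq_mono => i /=; rewrite ?mulr1 ?rev_blockK.
Qed.

Lemma adjm_revP : adjm revP = revP.
Proof.
rewrite adjm_mono; last exact: rev_blockK.
by apply: eq_mono => // i; rewrite rmorph1.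
Qed.

Lemma qc_revP : qc (Sy C d) revP = revP.
Proof.
apply/(qc_fix_comm Sy_sqr); rewrite SyE mconj_mono !monoM; apply: eq_mono => i /=.
  by rewrite flip_rev.
by rewrite rmorph1 mul1r mulr1 par_rev.
Qed.

Lemma antihomogeneous_revP (M : 'M[C]_(2 * d)) :
  antihomogeneous k M -> antihomogeneous k (revP *m M *m revP).
Proof.
move=> hM i j; rewrite mul_monoE; last exact: rev_blockK.
by rewrite mono_mulE mul1r mulr1 => /hM; rewrite !half_rev !kap_rev => /oppr_inj.
Qed.

Lemma revP_dz z : revP *m dz (fun i => - k i) z = dz k z *m revP.
Proof.
rewrite !dz_mono !monoM; apply: eq_mono => i //=.
by rewrite mul1r mulr1 half_rev kap_rev opprK.
Qed.

End Concrete.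

(** * Assembly of the factorization *)

Lemma quaternionic_skew_factorization (C : numClosedFieldType) (d : nat)
    (A : lpoly C (2 * d)) (kap : 'I_d -> int) :
  all (@is_quat C d) (lp_coef A) ->
  (forall z : C, z != 0 -> leval (ldagger A) z = - leval A z) ->
  sym_partial_indices A kap ->
  exists Ap : seq 'M[C]_(2 * d),
    all (@is_quat C d) Ap /\
    (forall z : C, `|z| <= 1 -> peval Ap z \in unitmx) /\
    (forall z : C, z != 0 ->
       leval A z = peval Ap z *m D4 kap z *m leval (ldagger (poly_lpoly Ap)) z).
Proof.
move=> /allP quatA skewA [kd [ap [am [uap [uam facA]]]]].
pose S := Sy C d; pose k (i : 'I_(2 * d)) := kap (half_ord i).
have SS : S *m S = 1%:M by exact: Sy_sqr.
have Sc : mconj S = - S by exact: mconj_Sy.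
have Sa : adjm S = S by exact: adjm_Sy.
have Sk : homogeneous k S by exact: homogeneous_Sy.
have Fq z : qc S (leval A z^*) = leval A z.
  rewrite /leval qc_sum; apply: eq_bigr => i _.
  rewrite qcZ fmorphXz /= conjCK; congr (_ *: _).
  by apply/eqP/quatA/mem_nth.
have Fa z : z != 0 -> adjm (leval A (z^*)^-1) = - leval A z.
  by move=> z0; rewrite -leval_ldagger // skewA.
pose Ap := matrix_poly_of_seq ap; pose Am := matrix_poly_of_seq am.
have uAp : invertible_on_disc Ap by move=> z z1; rewrite ev_matrix_poly_of_seq uap.
have uAm : invertible_on_disc Am by move=> z z1; rewrite ev_matrix_poly_of_seq uam.
have FA z : z != 0 -> leval A z = ev Ap z *m dz k z *m ev Am z^-1.
  by move=> z0; rewrite !ev_matrix_poly_of_seq facA.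
have [Bp [Bm [uBp uBm qBp FB]]] := quaternionic_factor SS Sc Sk uAp uAm (fun z _ => Fq z) FA.
have [krev [V [dV degV FV]]] := skew_factor kd uBp uBm FB Fa.
have kap_rev m : kap (rev_ord m) = - kap m.
  by have := krev (pair_ord m 0); rewrite /k half_rev_ord half_pair.
have k0 : \sum_i k i = 0.
  have : \sum_i k i = - \sum_i k i.
    by rewrite -sumrN {1}(reindex_inj rev_ord_inj); apply: eq_bigr => i _; exact: krev.
  lia.
have circ (z : C) : `|z| = 1 -> z != 0 by move=> z1; rewrite -normr_gt0 z1.
have Fa1 z : `|z| = 1 -> adjm (leval A z) = - leval A z.
  by move=> z1; rewrite -Fa ?circ // unit_circle_conj // invrK.
(* Chosen so that J D^-1 = P D_4 P, with P the block reversal, which is then absorbed into the plus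
   factor. *)
pose J := revP C d *m D4_one C kap *m revP C d.
have Ja : adjm J = - J.
  by rewrite !adjmM adjm_revP adjm_D4_one // mulNmx mulmxN mulmxA.
have Jq : qc S J = J by rewrite !qcM // qc_revP qc_D4_one.
have Jk : antihomogeneous k J.
  by apply: antihomogeneous_revP => //; exact: antihomogeneous_D4_one.
have JJ : J *m J = - 1%:M.
  rewrite /J !mulmxA -(mulmxA _ (revP C d) (revP C d)) revP_sqr mulmx1.
  rewrite -(mulmxA _ (D4_one C kap) (D4_one C kap)) D4_one_sqr //.
  by rewrite mulmxN mulmx1 mulNmx revP_sqr.
have [B [uB qB FBJ]] :=
  skew_normal_form SS Sc Sa Sk uBp qBp FV Fa1 (fun z _ => Fq z) dV k0 degV Ja Jq Jk JJ.
pose W := B *m map_mx polyC (revP C d).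
pose s := seq_of_matrix_poly W.
have revPu : revP C d \in unitmx by case: (mulmx1_unit (revP_sqr C d)).
exists s; split; [|split].
- have qW : qcp S W = W.
    apply: ev_eq_circle => z _; rewrite ev_qcp // !evM !evC qcM // qc_revP.
    by rewrite -ev_qcp // qB.
  (* Conjugation acts coefficientwise, so a fixed [W] has quaternionic coefficients. *)
  apply/allP => _ /mapP[m _ ->]; rewrite /is_quat -[in X in _ == X]qW.
  by rewrite /qcp coefmx_mulCr coefmx_mulCl coefmx_conjp.
- by move=> z z1; rewrite peval_seq_of_matrix_poly evM evC unitmx_mul uB.
(* Both sides are Laurent, so it suffices to compare them on the circle. *)
- apply: laurent_eq; first exact: laurent_leval.
    apply: laurentM; last exact: laurent_leval.
    apply: laurentM.
      by apply: laurent_ext (laurent_ev W) => z _; rewrite peval_seq_of_matrix_poly.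
    refine (laurent_ext _ (laurentM (laurent_ev (map_mx polyC (D4_one C kap))) (laurent_dz C k))).
    by move=> z _; rewrite evC D4E.
  move=> z z1; rewrite leval_ldagger ?circ // peval_leval unit_circle_conj // invrK.
  rewrite peval_seq_of_matrix_poly FBJ // D4E // evM evC adjmM adjm_revP !mulmxA.
  by congr (_ *m _); rewrite -[LHS]mulmxA [X in _ *m X](revP_dz kap_rev) mulmxA.
Qed.

Theorem theorem3p4 (R : realType) (d : nat) (A : lpoly R[i] (2 * d))
    (kap : 'I_d -> int) :
  all (@is_quat R[i] d) (lp_coef A) ->
  (forall z : R[i], z != 0 -> leval (ldagger A) z = - leval A z) ->
  (forall z : R[i], `|z| = 1 -> leval A z \in unitmx) ->
  sym_partial_indices A kap ->
  exists Ap : seq 'M[R[i]]_(2 * d),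
    all (@is_quat R[i] d) Ap /\
    (forall z : R[i], `|z| <= 1 -> peval Ap z \in unitmx) /\
    (forall z : R[i], z != 0 ->
       leval A z = peval Ap z *m D4 kap z *m leval (ldagger (poly_lpoly Ap)) z).
Proof.
by move=> quatA skewA _; exact: quaternionic_skew_factorization.
Qed.
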